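(* Consider problem (P) under Assumption 1, and let $\mathcal{G}$ be undirected and connected. Then for any $\alpha,\beta>0$ and any initial point $(\mathbf{w}(0),\boldsymbol\lambda(0),\mathbf{z}(0))\in\mathbb{R}^d\times\mathbb{R}^{np}\times\mathbb{R}^{np}$ with $\sum_{i=1}^n z_i(0)=0$, the signal $\mathbf{x}(t)=P_{\mathcal{X}}(\mathbf{w}(t))$ generated by Proj-IDEA converges to an optimal solution of (P).
   Context: Problem (P): for $i=1,\dots,n$ let $f_i:\mathbb{R}^{d_i}\to\mathbb{R}$, $\mathcal{X}_i\subseteq\mathbb{R}^{d_i}$, $A_i\in\mathbb{R}^{p\times d_i}$, $b\in\mathbb{R}^p$; $d=\sum_i d_i$, $\mathbf{x}=[x_1^\top,\dots,x_n^\top]^\top$, $f(\mathbf{x})=\sum_i f_i(x_i)$, $A=[A_1,\dots,A_n]$, $\mathcal{X}=\prod_i\mathcal{X}_i$; (P) is $\min f(\mathbf{x})$ s.t. $A\mathbf{x}=b$, $\mathbf{x}\in\mathcal{X}$, assumed to have at least one optimal solution. Assumption 1: each $\mathcal{X}_i$ closed and convex, $f_i$ convex on $\mathcal{X}_i$ and differentiable on an open set containing $\mathcal{X}_i$ with $\nabla f_i$ locally Lipschitz there, and Slater's condition holds (some relative interior point of $\mathcal{X}$ satisfies $A\mathbf{x}=b$). Graph: weighted graph with adjacency $[a_{ij}]$ ($a_{ij}>0$ if agent $i$ receives from agent $j$, else $0$), undirected meaning $a_{ij}=a_{ji}$, connected; Laplacian $L=\mathrm{diag}(\sum_j a_{ij})_i-[a_{ij}]$.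 Proj-IDEA: choose $b_1,\dots,b_n$ with $\sum_i b_i=b$; $\mathbf{A}=\mathrm{diag}(A_1,\dots,A_n)$, $\mathbf{b}=[b_1^\top,\dots,b_n^\top]^\top$, $\mathbf{L}=L\otimes I_p$, $\nabla f(\mathbf{x})=[\nabla f_1(x_1)^\top,\dots,\nabla f_n(x_n)^\top]^\top$, $P_{\mathcal{X}}$ the Euclidean projection onto $\mathcal{X}$, $\mathbf{z}=[z_1^\top,\dots,z_n^\top]^\top$. Proj-IDEA is $\dot{\mathbf{w}}=-\alpha(\mathbf{w}-\mathbf{x}+\nabla f(\mathbf{x})+\mathbf{A}^\top\boldsymbol\lambda)-\mathbf{A}^\top(\mathbf{A}\mathbf{x}-\mathbf{b}-\mathbf{z})$, $\dot{\boldsymbol\lambda}=\mathbf{A}\mathbf{x}-\mathbf{b}-\mathbf{z}-\beta\mathbf{L}\boldsymbol\lambda$, $\dot{\mathbf{z}}=\alpha\beta\mathbf{L}\boldsymbol\lambda$, $\mathbf{x}=P_{\mathcal{X}}(\mathbf{w})$. *)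

(* Defs.v *)
From HB Require Import structures.
From mathcomp Require Import all_boot all_order all_algebra.
From mathcomp Require Import all_classical all_reals all_analysis.
Set Implicit Arguments. Unset Strict Implicit. Unset Printing Implicit Defensive.
Import Order.TTheory GRing.Theory Num.Theory.
Import numFieldNormedType.Exports.
Local Open Scope classical_set_scope.
Local Open Scope ring_scope.

Section Defs.
Variable R : realType.

Definition dotv m (u v : 'cV[R]_m) : R := (u^T *m v) 0 0.
Definition enorm m (u : 'cV[R]_m) : R := Num.sqrt (dotv u u).

Definition convex_setv m (X : set 'cV[R]_m) : Prop :=
  forall x y t, X x -> X y -> 0 <= t <= 1 -> X (t *: x + (1 - t) *: y).
Definition convex_on m (X : set 'cV[R]_m) (g : 'cV[R]_m -> R) : Prop :=
  forall x y t, X x -> X y -> 0 <= t <= 1 ->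
    g (t *: x + (1 - t) *: y) <= t * g x + (1 - t) * g y.

Definition grad m (g : 'cV[R]_m -> R) (x : 'cV[R]_m) : 'cV[R]_m :=
  \col_(k < m) ('d g x (delta_mx k 0 : 'cV[R]_m)).

Definition loc_lipschitz_on m (U : set 'cV[R]_m) (h : 'cV[R]_m -> 'cV[R]_m) : Prop :=
  forall x, U x -> exists r : R, exists L : R, 0 < r /\
    forall y z, U y -> U z -> enorm (y - x) < r -> enorm (z - x) < r ->
      enorm (h y - h z) <= L * enorm (y - z).

Definition agent_regular m (X : set 'cV[R]_m) (g : 'cV[R]_m -> R) : Prop :=
  closed X /\ convex_setv X /\ convex_on X g /\
  exists U : set 'cV[R]_m, open U /\ X `<=` U /\
    (forall x, U x -> differentiable g x) /\ loc_lipschitz_on U (grad g).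

(** Stacked vectors x = [x_1; ...; x_n] in R^d, d = sum d_i, represented
    blockwise. *)
Definition stk n (d : 'I_n -> nat) := forall i : 'I_n, 'cV[R]_(d i).

Definition stk_sqdist n (d : 'I_n -> nat) (x y : stk d) : R :=
  \sum_(i < n) dotv (x i - y i) (x i - y i).

Definition prodset n (d : 'I_n -> nat) (X : forall i, set 'cV[R]_(d i)) : set (stk d) :=
  [set x | forall i, X i (x i)].

Definition aff_hull n (d : 'I_n -> nat) (S : set (stk d)) : set (stk d) :=
  [set y | exists k : nat, exists pts : 'I_k -> stk d, exists c : 'I_k -> R,
     (forall j, S (pts j)) /\ \sum_(j < k) c j = 1 /\
     forall i, y i = \sum_(j < k) c j *: pts j i].

Definition rel_interior n (d : 'I_n -> nat) (S : set (stk d)) : set (stk d) :=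
  [set x | S x /\ exists eps : R, 0 < eps /\
     forall y, aff_hull S y -> stk_sqdist x y < eps ^+ 2 -> S y].

Definition stk_mul n p (d : 'I_n -> nat) (A : forall i, 'M[R]_(p, d i)) (x : stk d)
  : 'cV[R]_p := \sum_(i < n) A i *m x i.

Definition feasible n p (d : 'I_n -> nat) (X : forall i, set 'cV[R]_(d i))
  (A : forall i, 'M[R]_(p, d i)) (b : 'cV[R]_p) (x : stk d) : Prop :=
  stk_mul A x = b /\ prodset X x.

Definition optimal n p (d : 'I_n -> nat) (f : forall i, 'cV[R]_(d i) -> R)
  (X : forall i, set 'cV[R]_(d i)) (A : forall i, 'M[R]_(p, d i)) (b : 'cV[R]_p)
  (x : stk d) : Prop :=
  feasible X A b x /\
  forall y, feasible X A b y -> \sum_(i < n) f i (x i) <= \sum_(i < n) f i (y i).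

Definition is_proj n (d : 'I_n -> nat) (X : forall i, set 'cV[R]_(d i)) (w x : stk d) : Prop :=
  prodset X x /\ forall y, prodset X y -> stk_sqdist w x <= stk_sqdist w y.

Definition undirected n (a : 'M[R]_n) : Prop := forall i j, a i j = a j i.
Definition nonneg_adj n (a : 'M[R]_n) : Prop := forall i j, 0 <= a i j.
Definition connected_graph n (a : 'M[R]_n) : Prop :=
  forall i j : 'I_n, connect (fun k l => 0 < a k l) i j.

Definition laplacian n (a : 'M[R]_n) : 'M[R]_n :=
  \matrix_(i, j) ((i == j)%:R * (\sum_(k < n) a i k) - a i j).

(** (L (x) I_p) lambda, block i. *)
Definition lapl_apply n p (a : 'M[R]_n) (lam : 'I_n -> 'cV[R]_p) (i : 'I_n) : 'cV[R]_p :=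
  \sum_(j < n) laplacian a i j *: lam j.

Definition proj_idea_traj n p (d : 'I_n -> nat) (f : forall i, 'cV[R]_(d i) -> R)
  (X : forall i, set 'cV[R]_(d i)) (A : forall i, 'M[R]_(p, d i))
  (bs : 'I_n -> 'cV[R]_p) (a : 'M[R]_n) (alpha beta : R)
  (w : R -> stk d) (lam z : R -> 'I_n -> 'cV[R]_p) (x : R -> stk d) : Prop :=
  (forall t : R, 0 <= t -> is_proj X (w t) (x t)) /\
  (forall i, {within [set t : R | 0 <= t], continuous (fun t => w t i)}) /\
  (forall i, {within [set t : R | 0 <= t], continuous (fun t => lam t i)}) /\
  (forall i, {within [set t : R | 0 <= t], continuous (fun t => z t i)}) /\
  (forall t : R, 0 < t -> forall i : 'I_n,
     is_derive t 1 (fun s => w s i)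
       (- alpha *: (w t i - x t i + grad (f i) (x t i) + (A i)^T *m lam t i)
        - (A i)^T *m (A i *m x t i - bs i - z t i)) /\
     is_derive t 1 (fun s => lam s i)
       (A i *m x t i - bs i - z t i - beta *: lapl_apply a (lam t) i) /\
     is_derive t 1 (fun s => z s i)
       ((alpha * beta) *: lapl_apply a (lam t) i)).

End Defs.

(* Main.v *)
Require Import Defs.
From HB Require Import structures.
From mathcomp Require Import all_boot all_order all_algebra.
From mathcomp Require Import all_classical all_reals all_analysis.
From mathcomp Require Import ring lra.
Set Implicit Arguments. Unset Strict Implicit. Unset Printing Implicit Defensive.
Import Order.TTheory GRing.Theory Num.Theory.
Import numFieldNormedType.Exports.
Local Open Scope classical_set_scope.
Local Open Scope ring_scope.

(** Slater's condition yields a multiplier [l] such that every point [y] of [X]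
satisfies [f y + <l, A y - b> >= fopt]. Let [L] be the Laplacian, [M] its inverse on
the vectors with zero block sum (where [z] stays, by symmetry of the graph),
[e = A x - b - z], and for an optimal [xs] put [zs = A xs - b]. The function
  [(|w - xs|^2 - |w - x|^2) / 2 + |z - zs + alpha (lam - l)|^2 / (2 alpha)
   + <z - zs, M (z - zs)> / (2 beta) + beta <lam, L lam> / 2]
decreases at least at the rate
  [alpha <x - xs, w - x> + alpha (f x - fopt + <l, A x - b>)
   + |e|^2 / 2 + beta^2 |L lam|^2 / 2],
a sum of nonnegative terms. Hence the trajectory is bounded, and by Barbalat's lemma
all these terms tend to 0; so every limit point [x'] of [x] is optimal, and along it
the function tends to [Q (x' - xs) + c], with [Q] a positive definite quadratic form
and [c] independent of [xs]. As the function converges for each optimal [xs], using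
it with two limit points [x1], [x2] in the role of [xs] gives
[Q (x1 - x2) + Q (x2 - x1) = 0], so there is only one limit point. *)

(** Neither the optimal solution nor the multiplier need be unique, and at a limit point [lam] is
    only known to lie in the kernel of the Laplacian, not to equal [l]. So the function need not
    tend to 0 even when [xs] is the limit point; this is why two limit points are compared, as in
    Opial's lemma, instead of recentring at one of them. The first bracket suits a variable [x] that
    is only a projection: its gradient in [w] is [x - xs], although [x] may fail to be
    differentiable. The price is that it dominates only [|x - xs|^2 / 2]. Boundedness of [w], used
    to make the dissipation Lipschitz in time for Barbalat's lemma, comes from the equation of [w]
    itself: linear damping plus a forcing that is bounded once the gradients are bounded along [x].
    Derivatives are available only for [t > 0], so uniform bounds are stated from time 1 on; the
    initial value enters only through the conserved sum of the [z_i]. *)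

(** * Lagrange multipliers for finitely many affine constraints *)

Section LagrangeMultipliers.
Context {R : realType} {T : Type} (comb : R -> T -> T -> T).
Implicit Types (S : set T) (h l : T -> R).

(** [comb t x y] stands for [t x + (1 - t) y]. No other vector structure is assumed on [T], so the
    result applies directly to stacked vectors, which are dependent families. *)
Definition comb_closed S := forall x y t, S x -> S y -> 0 <= t <= 1 -> S (comb t x y).
Definition comb_convex S h := forall x y t, S x -> S y -> 0 <= t <= 1 ->
  h (comb t x y) <= t * h x + (1 - t) * h y.
Definition comb_affine l := forall x y t, l (comb t x y) = t * l x + (1 - t) * l y.
(* The algebraic form of "[y0] is a relative interior point of the convex set
   [S]": every segment from a point of [S] to [y0] can be prolonged inside [S]. *)
Definition comb_internal S y0 := S y0 /\ forall y, S y ->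
  exists y' t, [/\ S y', 0 < t < 1 & comb t y y' = y0].

(* [mu] is the supremum of the slopes [- h y / l y] over the half [l > 0] of [S];
   mixing points of the two halves bounds it by those over [l < 0]. *)
Lemma lagrange_multiplier1 S h l y0 : comb_closed S -> comb_convex S h ->
  comb_affine l -> comb_internal S y0 -> l y0 = 0 ->
  (forall y, S y -> l y = 0 -> 0 <= h y) ->
  exists mu, forall y, S y -> 0 <= h y + mu * l y.
Proof.
move=> cS ch al [Sy0 iy0] ly0 hge0.
(* Prolonging the segment from [y] through [y0], where [l] vanishes, reaches a point at which the
   affine [l] has the opposite sign. *)
have opp y : S y -> l y != 0 -> exists2 y', S y' & l y' * l y < 0.
  move=> Sy ly; have [y' [t [Sy' t01 E]]] := iy0 y Sy; exists y' => //.
  have := al y y' t; rewrite E ly0 => /esym e.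
  have {}e : (1 - t) * (l y' * l y) = - (t * (l y * l y)).
    have e' : (1 - t) * l y' = - (t * l y) by lra.
    by rewrite mulrA e'; ring.
  have ly2 : 0 < l y * l y by rewrite -expr2 exprn_even_gt0.
  case/andP: t01 => t0 t1.
  rewrite -(pmulr_rlt0 _ (x := 1 - t)) ?subr_gt0// e oppr_lt0; exact: mulr_gt0.
have pair u v : S u -> S v -> 0 < l u -> l v < 0 -> 0 <= - l v * h u + l u * h v.
  move=> Su Sv lu lv.
  have D : 0 < l u - l v by rewrite subr_gt0 (lt_trans lv).
  (* The weight at which [l] vanishes on the mixture of [u] and [v]. *)
  pose t := - l v / (l u - l v).
  have t01 : 0 <= t <= 1.
    apply/andP; split; first by rewrite divr_ge0 ?oppr_ge0// ltW.
    rewrite ler_pdivrMr// mul1r; lra.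
  have Et : t * (l u - l v) = - l v by rewrite /t divfK// gt_eqF.
  have l0 : l (comb t u v) = 0.
    rewrite al; have -> : t * l u + (1 - t) * l v = t * (l u - l v) + l v by ring.
    by rewrite Et addNr.
  have := le_trans (hge0 _ (cS _ _ _ Su Sv t01) l0) (ch _ _ _ Su Sv t01).
  move=> H; have := mulr_ge0 (ltW D) H.
  have -> : (l u - l v) * (t * h u + (1 - t) * h v) =
    (t * (l u - l v)) * h u + (l u - l v - t * (l u - l v)) * h v by ring.
  rewrite Et; congr (_ <= _); ring.
have [[y1 [Sy1 ly1]]|nex] := pselect (exists y1, S y1 /\ l y1 != 0); last first.
  exists 0 => y Sy; rewrite mul0r addr0 hge0//.
  by apply/eqP; apply: contra_notT nex => ly; exists y.
have [[u Su lu] [v Sv lv]] : (exists2 u, S u & 0 < l u) /\ (exists2 v, S v & l v < 0).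
  have [y2 Sy2 H] := opp _ Sy1 ly1.
  have [l1|l1|l1] := ltgtP (l y1) 0; last by rewrite l1 eqxx in ly1.
  - by split; [exists y2|exists y1] => //; rewrite -(nmulr_llt0 _ l1).
  - by split; [exists y1|exists y2] => //; rewrite -(pmulr_llt0 _ l1).
pose E := [set - h y / l y | y in [set y | S y /\ 0 < l y]].
have E0 : E (- h u / l u) by exists u.
have ubE y : S y -> l y < 0 -> ubound E (h y / - l y).
  move=> Sy ly _ [y' [Sy' ly'] <-].
  have := pair _ _ Sy' Sy ly' ly.
  by rewrite ler_pdivrMr// mulrAC ler_pdivlMr ?oppr_gt0//; lra.
have hE : has_sup E by split; [exists (- h u / l u)|exists (h v / - l v); exact: ubE].
exists (sup E) => y Sy.
have [ly|ly|ly] := ltgtP (l y) 0; last by rewrite ly mulr0 addr0 hge0.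
- have : sup E <= h y / - l y by apply: ge_sup; [exists (- h u / l u)|exact: ubE].
  by rewrite ler_pdivlMr ?oppr_gt0//; lra.
- have : - h y / l y <= sup E by apply: ub_le_sup; [case: hE|exists y].
  by rewrite ler_pdivrMr//; lra.
Qed.

(** Induction on the number of constraints. On the slice where the first constraint vanishes, the
    induction hypothesis gives multipliers for the others; once these are absorbed into [h], a
    single constraint remains on [S]. The slice keeps [y0] internal: a segment from a point of the
    slice through [y0] stays in it when prolonged. *)
Lemma lagrange_multipliers (p : nat) S h (l : 'I_p -> T -> R) y0 :
  comb_closed S -> comb_convex S h -> (forall k, comb_affine (l k)) ->
  comb_internal S y0 -> (forall k, l k y0 = 0) ->
  (forall y, S y -> (forall k, l k y = 0) -> 0 <= h y) ->
  exists mu : 'I_p -> R, forall y, S y -> 0 <= h y + \sum_k mu k * l k y.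
Proof.
elim: p S h l => [|p IH] S h l cS ch al iy0 ly0 hge0.
  exists (fun=> 0) => y Sy; rewrite big_ord0 addr0 hge0// => -[//].
pose S' := S `&` [set y | l ord0 y = 0].
have [||||mu' Hmu'] := IH S' h (fun k => l (lift ord0 k)) _ _ (fun k => al _) _
  (fun k => ly0 _).
- move=> x y t [Sx lx] [Sy ly] t01; split; first exact: cS.
  by rewrite /= al lx ly !mulr0 addr0.
- by move=> x y t [Sx _] [Sy _]; exact: ch.
- case: iy0 => Sy0 iy0; split; [by split=> /=|move=> y [Sy ly]].
  have [y' [t [Sy' t01 e]]] := iy0 y Sy; exists y', t; split => //; split=> //=.
  have := al ord0 y y' t; rewrite e ly0 ly mulr0 add0r => /esym/eqP.
  case/andP: t01 => _ t1.
  by rewrite mulf_eq0 subr_eq0 gt_eqF//= => /eqP.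
- move=> y [Sy ly0'] lk; apply: hge0 => // k.
  by case: (unliftP ord0 k) => [k' ->|->].
have [||mu0 Hmu0] := @lagrange_multiplier1 S
  (fun y => h y + \sum_k mu' k * l (lift ord0 k) y) (l ord0) y0 cS _ (al _) iy0 (ly0 _).
- move=> x y t Sx Sy t01 /=.
  apply: le_trans (lerD (ch _ _ _ Sx Sy t01) (lexx _)) _.
  rewrite !mulrDr addrACA lerD2l !mulr_sumr -big_split/= ler_sum// => k _.
  by rewrite al le_eqVlt; apply/orP; left; apply/eqP; ring.
- by move=> y Sy ly; exact: Hmu'.
exists (fun k => if unlift ord0 k is Some k' then mu' k' else mu0) => y Sy.
rewrite big_ord_recl unlift_none.
under eq_bigr do rewrite liftK.
by rewrite (addrC (mu0 * _)) addrA Hmu0.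
Qed.

End LagrangeMultipliers.

(** * The Euclidean inner product *)

Section Dot.
Context {R : realType}.

Lemma dotvE m (u v : 'cV[R]_m) : dotv u v = \sum_k u k 0 * v k 0.
Proof. by rewrite /dotv mxE; apply: eq_bigr => k _; rewrite mxE. Qed.

Lemma dotvC m (u v : 'cV[R]_m) : dotv u v = dotv v u.
Proof. by rewrite !dotvE; apply: eq_bigr => k _; rewrite mulrC. Qed.

Lemma dotvDl m (u v w : 'cV[R]_m) : dotv (u + v) w = dotv u w + dotv v w.
Proof. by rewrite !dotvE -big_split; apply: eq_bigr => k _; rewrite mxE mulrDl. Qed.

Lemma dotvZl m c (u v : 'cV[R]_m) : dotv (c *: u) v = c * dotv u v.
Proof. by rewrite !dotvE mulr_sumr; apply: eq_bigr => k _; rewrite mxE mulrA. Qed.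

Lemma dotvDr m (u v w : 'cV[R]_m) : dotv u (v + w) = dotv u v + dotv u w.
Proof. by rewrite !(dotvC u) dotvDl. Qed.

Lemma dotvZr m c (u v : 'cV[R]_m) : dotv u (c *: v) = c * dotv u v.
Proof. by rewrite !(dotvC u) dotvZl. Qed.

Lemma dotvNl m (u v : 'cV[R]_m) : dotv (- u) v = - dotv u v.
Proof. by rewrite -scaleN1r dotvZl mulN1r. Qed.

Lemma dotvNr m (u v : 'cV[R]_m) : dotv u (- v) = - dotv u v.
Proof. by rewrite !(dotvC u) dotvNl. Qed.

Lemma dotv0l m (u : 'cV[R]_m) : dotv 0 u = 0.
Proof. by rewrite -(scale0r 0) dotvZl mul0r. Qed.

Lemma dotv0r m (u : 'cV[R]_m) : dotv u 0 = 0.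
Proof. by rewrite dotvC dotv0l. Qed.

Definition dotv_lin := (dotvDl, dotvDr, dotvNl, dotvNr, dotvZl, dotvZr).

Lemma dotv_suml (I : finType) m (u : I -> 'cV[R]_m) v :
  dotv (\sum_i u i) v = \sum_i dotv (u i) v.
Proof.
by apply: (big_ind2 (fun x y => dotv x v = y)) => // [|x1 y1 x2 y2 <- <-];
  rewrite ?dotv0l ?dotvDl.
Qed.

Lemma dotv_sumr (I : finType) m (u : I -> 'cV[R]_m) v :
  dotv v (\sum_i u i) = \sum_i dotv v (u i).
Proof. by rewrite dotvC dotv_suml; apply: eq_bigr => i _; rewrite dotvC. Qed.

Lemma dotv_trmx m q (A : 'M[R]_(q, m)) u v : dotv u (A^T *m v) = dotv (A *m u) v.
Proof. by rewrite /dotv trmx_mul mulmxA. Qed.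

Lemma dotv_ge0 m (u : 'cV[R]_m) : 0 <= dotv u u.
Proof. by rewrite dotvE sumr_ge0// => k _; rewrite -expr2 sqr_ge0. Qed.

Lemma sqr_coord_le_dotv m (u : 'cV[R]_m) k : u k 0 ^+ 2 <= dotv u u.
Proof.
rewrite dotvE (bigD1 k)//= -expr2 lerDl sumr_ge0// => j _.
by rewrite -expr2 sqr_ge0.
Qed.

Lemma dotv_eq0 m (u : 'cV[R]_m) : dotv u u = 0 -> u = 0.
Proof.
move=> u0; apply/colP => k; rewrite mxE; apply/eqP; rewrite -sqrf_eq0.
by rewrite eq_le sqr_ge0 andbT -u0 sqr_coord_le_dotv.
Qed.

Lemma dotv_young m (u v : 'cV[R]_m) : 2 * dotv u v <= dotv u u + dotv v v.
Proof.
by have := dotv_ge0 (u - v); rewrite !dotv_lin (dotvC v u); lra.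
Qed.

Lemma dotv_le_diff m (u v : 'cV[R]_m) : dotv u u <= 2 * dotv (u - v) (u - v) + 2 * dotv v v.
Proof.
by have := dotv_ge0 (u - 2 *: v); rewrite !dotv_lin (dotvC v u); lra.
Qed.

End Dot.

(** * Limits along filters, and compactness through ultrafilters *)

Section FilterLimits.
Context {R : realType} {T : Type} {F : set_system T}.

Lemma cvg_coord {FF : Filter F} m (g : T -> 'cV[R]_m) (l : 'cV[R]_m) k :
  g @ F --> l -> g t k 0 @[t --> F] --> l k 0.
Proof.
by move=> gl; apply: (cvg_comp _ (fun M : 'cV[R]_m => M k 0) gl); exact: coord_continuous.
Qed.

Lemma cvg_sum_fin {FF : Filter F} (I : finType) (V : normedModType R)
    (f : I -> T -> V) (l : I -> V) :
  (forall i, f i t @[t --> F] --> l i) -> \sum_i f i t @[t --> F] --> \sum_i l i.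
Proof.
by move=> fl; apply: cvg_big => [|i _]; [exact: add_continuous|exact: fl].
Qed.

Lemma cvg_colP {FF : Filter F} m (g : T -> 'cV[R]_m) (l : 'cV[R]_m) :
  (forall k, g t k 0 @[t --> F] --> l k 0) -> g @ F --> l.
Proof.
have e (v : 'cV[R]_m) : \sum_k v k 0 *: delta_mx k 0 = v.
  rewrite [RHS]matrix_sum_delta; apply: eq_bigr => i _.
  by rewrite big_ord1.
move=> gl.
have : \sum_k g t k 0 *: (delta_mx k 0 : 'cV[R]_m) @[t --> F] -->
       \sum_k l k 0 *: (delta_mx k 0 : 'cV[R]_m).
  by apply: cvg_sum_fin => k; apply: cvgZr_tmp; exact: gl.
by rewrite e; under eq_cvg do rewrite e.
Qed.

Lemma cvg_dotv {FF : Filter F} m (g h : T -> 'cV[R]_m) (a b : 'cV[R]_m) :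
  g @ F --> a -> h @ F --> b -> dotv (g t) (h t) @[t --> F] --> dotv a b.
Proof.
move=> ga hb; rewrite dotvE; under eq_cvg do rewrite dotvE.
by apply: cvg_sum_fin => k; apply: cvgM; exact: cvg_coord.
Qed.

Lemma cvg_mulmx {FF : Filter F} m q (A : 'M[R]_(q, m)) (g : T -> 'cV[R]_m) (l : 'cV[R]_m) :
  g @ F --> l -> A *m g t @[t --> F] --> A *m l.
Proof.
move=> gl; apply: cvg_colP => k; rewrite mxE; under eq_cvg do rewrite mxE.
by apply: cvg_sum_fin => j; apply: cvgMl_tmp; exact: cvg_coord.
Qed.

Lemma ultra_bounded_cvg {FU : UltraFilter F} (g : T -> R) (C : R) :
  F [set t | `|g t| <= C] -> exists l : R, g @ F --> l.
Proof.
move=> FC.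
have H : F (g @^-1` `[- C, C]%classic).
  by apply: filterS FC => t /=; rewrite ler_norml in_itv.
have [l [_ cl]] := @segment_compact R (- C) C (g @ F) _ H.
exists l => U Ul.
have [//|nU] := in_ultra_setVsetC (g @^-1` U) FU.
by have [y [nUy Uy]] := cl (~` U) U nU Ul; case: (nUy Uy).
Qed.

Lemma ultra_bounded_cvg_col {FU : UltraFilter F} m (g : T -> 'cV[R]_m) (C : R) :
  F [set t | forall k, `|g t k 0| <= C] -> exists l : 'cV[R]_m, g @ F --> l.
Proof.
move=> FC.
have /choice[l Hl] k : exists l : R, g t k 0 @[t --> F] --> l.
  by apply: (ultra_bounded_cvg (C := C)); apply: filterS FC => t /=.
by exists (\col_k l k); apply: cvg_colP => k; rewrite mxE.
Qed.

(** Since [P] is not eventually true, its complement is compatible with [F]. Applied at infinity,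
    this produces a limit point that stays away from a given one. *)
Lemma ultra_not_near {FF : ProperFilter F} (P : set T) : ~ F P ->
  exists G, [/\ UltraFilter G, F `<=` G & G (~` P)].
Proof.
move=> nP.
have W : ProperFilter (within (~` P) F).
  apply: Build_ProperFilter_ex => Q FQ.
  have {}FQ : F [set t | ~ P t -> Q t] := FQ.
  apply: contrapT => nQ; apply: nP; apply: filterS FQ => t /= H.
  by apply: contrapT => nPt; apply: nQ; exists t; exact: H.
have [G [UG sG]] := ultraFilterLemma W.
exists G; split => //; last by apply: sG; exact: withinT.
by move=> Q FQ; apply: sG; exact: (@cvg_within _ F _ (~` P) Q FQ).
Qed.

End FilterLimits.

(** * One-variable calculus: monotone convergence, Barbalat, Gronwall *)

Section Calculus.
Context {R : realType}.
Implicit Types (V g h : R -> R) (s t r B C c k e : R).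

Lemma is_derive_coord m (u : R -> 'cV[R]_m) du t (k : 'I_m) :
  is_derive t 1 u du -> is_derive t 1 (fun s => u s k 0) (du k 0).
Proof.
move=> [ud ue]; apply: DeriveDef.
  by move/derivable_mxP : ud; exact.
by rewrite -ue derive_mx// mxE.
Qed.

Lemma is_derive_dotv m (u v : R -> 'cV[R]_m) du dv (t : R) :
  is_derive t 1 u du -> is_derive t 1 v dv ->
  is_derive t 1 (fun s => dotv (u s) (v s)) (dotv du (v t) + dotv (u t) dv).
Proof.
move=> hu hv.
rewrite (_ : (fun s => _) = \sum_k (fun s => u s k 0 * v s k 0)); last first.
  by apply/funext => s; rewrite dotvE fct_sumE.
rewrite !dotvE -big_split/=; apply: is_derive_sum => k.
have hk := is_derive_coord k hu; have hk' := is_derive_coord k hv.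
apply: is_derive_eq; rewrite /= !/GRing.scale/=; ring.
Qed.

Lemma is_derive_lincomb m (I : finType) (c : I -> R) (u : I -> R -> 'cV[R]_m) du (t : R) :
  (forall i, is_derive t 1 (u i) (du i)) ->
  is_derive t 1 (fun s => \sum_i c i *: u i s) (\sum_i c i *: du i).
Proof.
move=> hu.
rewrite (_ : (fun s => _) = \sum_i (c i *: u i)); last first.
  by apply/funext => s; rewrite fct_sumE.
rewrite /index_enum; elim: (locked_with _ _) => [|i s IH].
  by rewrite !big_nil; exact: is_derive_cst.
rewrite !big_cons; exact: is_deriveD.
Qed.

Lemma MVT_pos V (dV : R -> R) s t : (forall r, 0 < r -> is_derive r 1 V (dV r)) ->
  0 < s -> s < t -> exists2 c, s < c < t & V t - V s = dV c * (t - s).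
Proof.
move=> hV s0 st.
have [||c] := @MVT R V dV s t st.
- by move=> r; rewrite in_itv/= => /andP[sr _]; apply: hV; exact: lt_trans sr.
- apply: derivable_within_continuous => r; rewrite in_itv/= => /andP[sr _].
  by have [] := hV r (lt_le_trans s0 sr).
- by rewrite in_itv/= => cst e; exists c.
Qed.

Lemma nonincreasing_pos V (dV : R -> R) : (forall r, 0 < r -> is_derive r 1 V (dV r)) ->
  (forall r, 0 < r -> dV r <= 0) -> forall s t, 0 < s -> s <= t -> V t <= V s.
Proof.
move=> hV dV0 s t s0; rewrite le_eqVlt => /predU1P[->//|st].
have [c /andP[sc _] e] := MVT_pos hV s0 st.
rewrite -subr_le0 e mulr_le0_ge0 ?subr_ge0 ?(ltW st)//.
by rewrite dV0// (lt_trans s0).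
Qed.

Lemma nonincreasing_cvg V B : (forall s t, 1 <= s -> s <= t -> V t <= V s) ->
  (forall t, 1 <= t -> B <= V t) -> exists l : R, V t @[t --> +oo] --> l.
Proof.
move=> hV hB; pose E := [set V t | t in [set t | 1 <= t]].
have hE : has_inf E.
  by split; [exists (V 1), 1 => /=|exists B => _ [t t1 <-]; exact: hB].
exists (inf E); apply/cvgrPdist_lt => e e0.
have [_ [t0 t01 <-] ht0] := inf_adherent e0 hE.
near=> t.
have tt0 : t0 <= t by near: t; apply: nbhs_pinfty_ge; exact: num_real.
have t1 : 1 <= t by rewrite (le_trans _ tt0).
have h1 : inf E <= V t by apply: ge_inf; [case: hE|exists t].
by rewrite distrC ger0_norm ?subr_ge0// ltrBlDl (le_lt_trans (hV _ _ t01 tt0)).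
Unshelve. all: by end_near. Qed.

(* Barbalat's lemma: where [h] exceeds [e], the Lipschitz bound keeps it above
   [e / 2] on an interval of fixed length, on which [V] loses a fixed amount. *)
Lemma barbalat V (dV : R -> R) h B C :
  (forall t, 0 < t -> is_derive t 1 V (dV t)) ->
  (forall t, 0 < t -> dV t <= - h t) -> (forall t, 0 < t -> 0 <= h t) ->
  (forall t, 1 <= t -> B <= V t) ->
  (forall s t, 1 <= s -> 1 <= t -> `|h t - h s| <= C * `|t - s|) ->
  h t @[t --> +oo] --> (0 : R).
Proof.
move=> hV hd h0 hB hC.
have ninc : forall s t, 0 < s -> s <= t -> V t <= V s.
  by apply: nonincreasing_pos hV _ => r r0; rewrite (le_trans (hd r r0))// oppr_le0 h0.
have [l Vl] : exists l : R, V t @[t --> +oo] --> l.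
  by apply: nonincreasing_cvg hB => s t s1; apply: ninc; rewrite (lt_le_trans _ s1).
apply/cvgrPdist_lt => e e0.
(* [C'] is positive whatever the sign of [C]; over a time [D] the function [h] can drop by at most
   [e / 2]. *)
pose C' := `|C| + 1; have C'0 : 0 < C' by rewrite ltr_pwDr.
pose D := e / (2 * C'); have D0 : 0 < D by rewrite divr_gt0// mulr_gt0.
(* Past [M], two values of [V] differ by less than [D * e / 2], the loss that [h >= e / 2] would
   force over a time [D]. *)
have [M [_ hM]] : \forall t \near +oo, `|l - V t| < D * e / 4.
  by move/cvgrPdist_lt : Vl; apply; rewrite divr_gt0// mulr_gt0.
near=> t.
have t1 : 1 <= t by near: t; apply: nbhs_pinfty_ge; exact: num_real.
have tM : M < t by near: t; apply: nbhs_pinfty_gt; exact: num_real.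
have t0 : 0 < t by rewrite (lt_le_trans _ t1).
rewrite sub0r normrN ger0_norm ?h0// ltNge; apply/negP => eh.
have tD : t < t + D by rewrite ltrDl.
have [c /andP[tc ct] ec] := MVT_pos hV t0 tD.
have hc : e / 2 <= h c.
  have := hC t c t1 (le_trans t1 (ltW tc)).
  rewrite (gtr0_norm (x := c - t)) ?subr_gt0// => H.
  have : C * (c - t) <= C' * D.
    apply: (@le_trans _ _ (C' * (c - t))).
      by rewrite ler_wpM2r ?subr_ge0 ?(ltW tc)// /C' (le_trans (ler_norm _))// lerDl.
    by rewrite ler_wpM2l ?(ltW C'0)// lerBlDl ltW.
  have -> : C' * D = e / 2 by rewrite /D; field; rewrite gt_eqF.
  move=> H'; have := le_trans H H'; rewrite ler_norml => /andP[+ _]; lra.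
have c0 : 0 < c by rewrite (lt_trans t0).
have : V (t + D) - V t <= - (e / 2) * D.
  rewrite ec addrAC subrr add0r ler_wpM2r ?(ltW D0)//.
  by rewrite (le_trans (hd c c0))// lerN2.
have := hM t tM; have := hM (t + D) (lt_trans tM _).
rewrite ltrDl => /(_ D0); rewrite !ltr_norml => /andP[H1 H2] /andP[H3 H4] H5.
lra.
Unshelve. all: by end_near. Qed.

Lemma gronwall_bounded V (dV : R -> R) c k :
  (forall t, 0 < t -> is_derive t 1 V (dV t)) -> 0 < c -> 0 <= k ->
  (forall t, 1 <= t -> dV t <= - c * V t + k) ->
  forall t, 1 <= t -> V t <= `|V 1| + k / c.
Proof.
move=> hV c0 k0 hd t; rewrite le_eqVlt => /predU1P[<-|t1].
  by rewrite (le_trans (ler_norm _))// lerDl divr_ge0// ltW.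
(* Integrating factor: [k / c] is the equilibrium of [V' = - c V + k], and the differential
   inequality makes [G] nonincreasing from time 1 on. *)
pose G s := (V s - k / c) * expR (c * s).
have hG r : 0 < r -> is_derive r 1 G ((dV r + c * V r - k) * expR (c * r)).
  move=> r0; have hr := hV r r0; rewrite /G.
  have hE : is_derive r 1 (fun s => expR (c * s)) (c * expR (c * r)).
    have h1 : is_derive r 1 (fun s : R => c * s) c.
      by apply: is_derive_eq; rewrite /GRing.scale/= mulr1.
    by have := is_derive1_comp (is_derive_expR (c * r)) h1; rewrite mulrC.
  apply: is_derive_eq; rewrite /GRing.scale/= subr0.
  have -> : (V r - k / c) * (c * expR (c * r)) + expR (c * r) * dV r =
    (c * V r - k / c * c + dV r) * expR (c * r) by ring.
  by rewrite divfK ?gt_eqF//; ring.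
have [s /andP[s1 _] e] := MVT_pos hG ltr01 t1.
have : G t <= G 1.
  rewrite -subr_le0 e mulr_le0_ge0 ?subr_ge0 ?(ltW t1)//.
  rewrite mulr_le0_ge0 ?expR_ge0//.
  by have := hd s (ltW s1); lra.
rewrite /G mulr1 => H.
have H1 : V t - k / c <= (V 1 - k / c) * (expR c / expR (c * t)).
  by rewrite mulrA ler_pdivlMr ?expR_gt0.
have /andP[E0 E1] : 0 <= expR c / expR (c * t) <= 1.
  rewrite divr_ge0 ?expR_ge0//= ler_pdivrMr ?expR_gt0// mul1r ler_expR.
  by rewrite ler_peMr ?(ltW c0) ?(ltW t1).
have : (V 1 - k / c) * (expR c / expR (c * t)) <= `|V 1|.
  apply: (@le_trans _ _ (`|V 1| * (expR c / expR (c * t)))).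
    by rewrite ler_wpM2r// (le_trans _ (ler_norm _))// gerBl divr_ge0// ltW.
  by rewrite ler_piMr.
by move=> H2; have := le_trans H1 H2; lra.
Qed.

End Calculus.

(** * The graph Laplacian acting on block vectors, and its inverse *)

Section Laplacian.
Context {R : realType} {n p : nat}.
Implicit Types (B C : 'M[R]_n) (u v z : 'I_n -> 'cV[R]_p).

(* The block action of [B (x) I_p], so that [lapl_apply a] is
   [blockmul (laplacian a)]. *)
Definition blockmul B u i := \sum_(j < n) B i j *: u j.

Lemma blockmulM B C u i : blockmul (B *m C) u i = blockmul B (blockmul C u) i.
Proof.
rewrite /blockmul; under eq_bigr do rewrite mxE scaler_suml.
rewrite exchange_big/=; apply: eq_bigr => j _.
by rewrite scaler_sumr; apply: eq_bigr => k _; rewrite scalerA.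
Qed.

Lemma eq_blockmul B u v : u =1 v -> blockmul B u =1 blockmul B v.
Proof. by move=> uv i; apply: eq_bigr => j _; rewrite uv. Qed.

Lemma blockmulDl B C u i : blockmul (B + C) u i = blockmul B u i + blockmul C u i.
Proof.
by rewrite /blockmul -big_split; apply: eq_bigr => j _; rewrite mxE scalerDl.
Qed.

Lemma blockmulD B u v i :
  blockmul B (fun j => u j + v j) i = blockmul B u i + blockmul B v i.
Proof. by rewrite /blockmul -big_split; apply: eq_bigr => j _; rewrite scalerDr. Qed.

Lemma blockmulZ B c u i : blockmul B (fun j => c *: u j) i = c *: blockmul B u i.
Proof.
by rewrite /blockmul scaler_sumr; apply: eq_bigr => j _; rewrite !scalerA mulrC.
Qed.

Lemma blockmul1 u i : blockmul 1%:M u i = u i.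
Proof.
rewrite /blockmul (bigD1 i)//= mxE eqxx scale1r big1 ?addr0// => j ji.
by rewrite mxE eq_sym (negbTE ji) scale0r.
Qed.

Lemma dotv_blockmul B u v : B^T = B ->
  \sum_i dotv (u i) (blockmul B v i) = \sum_i dotv (blockmul B u i) (v i).
Proof.
move=> BT; under eq_bigr do rewrite dotv_sumr.
rewrite exchange_big/=; apply: eq_bigr => j _; rewrite dotv_suml.
by apply: eq_bigr => i _; rewrite dotvZr dotvZl -[in RHS]BT mxE.
Qed.

Variable a : 'M[R]_n.
Hypotheses (a_ge0 : nonneg_adj a) (a_sym : undirected a) (a_conn : connected_graph a).
Local Notation L := (laplacian a).

Lemma tr_laplacian : L^T = L.
Proof.
apply/matrixP => i j; rewrite !mxE a_sym eq_sym.
by case: eqP => [->//|_]; rewrite !mul0r.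
Qed.

Lemma blockmul_laplacian u i : blockmul L u i = \sum_j a i j *: (u i - u j).
Proof.
rewrite /blockmul; under eq_bigr do rewrite mxE scalerBl.
under [RHS]eq_bigr do rewrite scalerBr.
rewrite !sumrB; congr (_ - _).
rewrite (bigD1 i)//= eqxx mul1r [X in _ + X]big1 ?addr0 ?scaler_suml// => j ji.
by rewrite eq_sym (negbTE ji) mul0r scale0r.
Qed.

Lemma laplacian_cst (c : 'cV[R]_p) i : blockmul L (fun=> c) i = 0.
Proof. by rewrite blockmul_laplacian big1// => j _; rewrite subrr scaler0. Qed.

(** The squared norm of the sum [c] pairs [c] with [L u]; by symmetry [L] moves onto the constant
    family [c], which it annihilates. *)
Lemma sum_laplacian u : \sum_i blockmul L u i = 0.
Proof.
apply: dotv_eq0; rewrite dotv_suml; set c := \sum_i _.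
rewrite -(dotv_blockmul u (fun=> c) tr_laplacian) big1// => i _.
by rewrite laplacian_cst dotv0r.
Qed.

Lemma laplacian_form u : 2 * \sum_i dotv (u i) (blockmul L u i) =
  \sum_i \sum_j a i j * dotv (u i - u j) (u i - u j).
Proof.
have e1 : \sum_i dotv (u i) (blockmul L u i) =
    \sum_i \sum_j a i j * dotv (u i) (u i - u j).
  apply: eq_bigr => i _; rewrite blockmul_laplacian dotv_sumr.
  by apply: eq_bigr => j _; rewrite dotvZr.
have e2 : \sum_i dotv (u i) (blockmul L u i) =
    \sum_i \sum_j a i j * dotv (u j) (u j - u i).
  by rewrite e1 exchange_big/=; under eq_bigr do under eq_bigr do rewrite a_sym.
rewrite mulr2n mulrDl mul1r {1}e1 e2 -big_split; apply: eq_bigr => i _.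
rewrite -big_split; apply: eq_bigr => j _ /=.
by rewrite !dotv_lin (dotvC (u j) (u i)); ring.
Qed.

Lemma laplacian_form_ge0 u : 0 <= \sum_i dotv (u i) (blockmul L u i).
Proof.
rewrite -(pmulr_rge0 _ (ltr0Sn R 1)) laplacian_form.
by do 2![apply: sumr_ge0 => ? _]; rewrite mulr_ge0 ?a_ge0 ?dotv_ge0.
Qed.

Lemma laplacian_form_le u : \sum_i dotv (u i) (blockmul L u i) <=
  2 * (\sum_i \sum_j a i j) * \sum_i dotv (u i) (u i).
Proof.
rewrite -(ler_pM2l (ltr0Sn R 1)) laplacian_form mulrA.
have -> : 2 * (2 * \sum_i \sum_j a i j) * \sum_i dotv (u i) (u i) =
   \sum_i \sum_j a i j * (4 * \sum_i dotv (u i) (u i)).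
  (* The factor 4 comes from [|u_i - u_j|^2 <= 2 |u_i|^2 + 2 |u_j|^2], each square being at most the
     whole sum. *)
  under [RHS]eq_bigr do rewrite -mulr_suml.
  by rewrite -mulr_suml; ring.
apply: ler_sum => i _; apply: ler_sum => j _; apply: ler_wpM2l; first exact: a_ge0.
have S k : dotv (u k) (u k) <= \sum_i dotv (u i) (u i).
  by rewrite (bigD1 k)//= lerDl sumr_ge0// => ? _; exact: dotv_ge0.
have := S i; have := S j; have := dotv_ge0 (u i + u j).
by rewrite !dotv_lin (dotvC (u j) (u i)); lra.
Qed.

Lemma sum_laplacian_addJ u :
  \sum_i blockmul (L + const_mx 1) u i = n%:R *: \sum_i u i.
Proof.
under eq_bigr do rewrite blockmulDl.
rewrite big_split/= sum_laplacian add0r.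
under eq_bigr do rewrite /blockmul; under eq_bigr do under eq_bigr do rewrite mxE scale1r.
by rewrite sumr_const card_ord scaler_nat.
Qed.

End Laplacian.

Section LaplacianInverse.
Context {R : realType} {n p : nat}.
Variable a : 'M[R]_n.
Hypotheses (a_ge0 : nonneg_adj a) (a_sym : undirected a) (a_conn : connected_graph a).
Local Notation L := (laplacian a).

(** Adding the all-ones matrix multiplies the sum of a vector by [n], so a kernel vector has zero
    sum and lies in the kernel of [L]. The quadratic form then makes it constant along edges,
    connectedness makes it constant, and the zero sum makes it 0. Blocks of size 1 make the block
    lemmas applicable. *)
Lemma laplacian_addJ_unit : L + const_mx 1 \in unitmx.
Proof.
rewrite unitmxE unitfE; apply/negP => /det0P[v v0 vL].
case/negP: v0.
pose u i : 'cV[R]_1 := (v 0 i)%:M.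
have Lu i : blockmul (L + const_mx 1) u i = 0.
  have uE j k : u j k 0 = v 0 j by rewrite mxE !ord1 mulr1n.
  have NS j : (L + const_mx 1) i j = (L + const_mx 1) j i.
    by rewrite mxE -[in LHS]tr_laplacian// mxE; symmetry; rewrite !mxE.
  apply/colP => k; rewrite /blockmul summxE [RHS]mxE.
  have /matrixP/(_ 0 i) := vL; rewrite [LHS]mxE [RHS]mxE => e; rewrite -[RHS]e.
  by apply: eq_bigr => j _; rewrite mxE uE NS mulrC.
have su : \sum_i u i = 0.
  have := sum_laplacian_addJ a_sym u; rewrite big1// => /esym/eqP.
  rewrite scaler_eq0 pnatr_eq0 => /orP[/eqP n0|/eqP//].
  by apply: big1 => -[i ilt]; exfalso; rewrite n0 in ilt.
have Lu' i : blockmul L u i = 0.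
  have := Lu i; rewrite blockmulDl [X in _ + X]/blockmul.
  under eq_bigr do rewrite mxE scale1r.
  by rewrite su addr0.
have : \sum_i \sum_j a i j * dotv (u i - u j) (u i - u j) = 0.
  by rewrite -laplacian_form// big1 ?mulr0// => i _; rewrite Lu' dotv0r.
have nn i j : 0 <= a i j * dotv (u i - u j) (u i - u j) by rewrite mulr_ge0 ?a_ge0 ?dotv_ge0.
move=> /psumr_eq0P H.
have {}H i j : 0 < a i j -> u i = u j.
  move=> aij.
  have /psumr_eq0P H' := H (fun i _ => sumr_ge0 _ (fun j _ => nn i j)) i isT.
  have /eqP := H' (fun j _ => nn i j) j isT.
  by rewrite mulf_eq0 gt_eqF//= => /eqP/dotv_eq0/eqP; rewrite subr_eq0 => /eqP.
have uc i j : u i = u j.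
  have /connectP[s + ->] := a_conn i j.
  elim: s i => [//|k s IH] i /= /andP[ik sk].
  by rewrite (H _ _ ik) IH.
apply/eqP/rowP => i; rewrite mxE.
have : n%:R *: u i = 0.
  transitivity (\sum_j u j); last exact: su.
  rewrite (eq_bigr (fun=> u i)) => [|j _]; last exact: uc.
  by rewrite sumr_const card_ord scaler_nat.
move/eqP; rewrite scaler_eq0 pnatr_eq0 => /orP[/eqP n0|/eqP/matrixP/(_ 0 0)].
  by exfalso; have := ltn_ord i; move: (nat_of_ord i) => k; rewrite n0.
by rewrite !mxE eqxx mulr1n.
Qed.

(* On the hyperplane [sum_i z_i = 0] the matrix [M = (L + 1 1^T)^-1] inverts [L].
   The bound expands the nonnegative form of [L] at [z - K M z]. *)
Lemma laplacian_green : exists (M : 'M[R]_n) (K : R), [/\ M^T = M, 0 < K &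
  forall z : 'I_n -> 'cV[R]_p, \sum_i z i = 0 ->
    blockmul L (blockmul M z) =1 z /\
    \sum_i dotv (z i) (z i) <= K * \sum_i dotv (z i) (blockmul M z i)].
Proof.
pose N := L + const_mx 1; pose M := invmx N; pose T := \sum_i \sum_j a i j.
have NM : N *m M = 1%:M by rewrite mulmxV ?laplacian_addJ_unit.
have NT : N^T = N by rewrite /N linearD/= tr_laplacian// trmx_const.
have T0 : 0 <= T by do 2![apply: sumr_ge0 => ? _]; exact: a_ge0.
(* [2 * T] is the crude bound of [laplacian_form_le]; the added 1 keeps the constant positive for a
   graph without edges. *)
exists M, (2 * T + 1); split; first by rewrite trmx_inv NT.
  by rewrite ltr_wpDl// mulr_ge0.
move=> z z0.
have NMz i : blockmul N (blockmul M z) i = z i by rewrite -blockmulM NM blockmul1.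
(* [N] multiplies block sums by [n] and sends [M z] to [z], so [M z] has zero sum too and the
   all-ones part of [N] does not act on it. *)
have LMz : blockmul L (blockmul M z) =1 z.
  have : \sum_i blockmul N (blockmul M z) i = 0 by rewrite (eq_bigr z).
  rewrite sum_laplacian_addJ// => /eqP; rewrite scaler_eq0 pnatr_eq0.
  move=> /orP[/eqP n0 i|/eqP s i].
    by exfalso; have := ltn_ord i; move: (nat_of_ord i) => k; rewrite n0.
  rewrite -[RHS]NMz blockmulDl [X in _ = _ + X]/blockmul.
  by under [in RHS]eq_bigr do rewrite mxE scale1r; rewrite s addr0.
split=> //.
set K := 2 * T + 1; have K0 : 0 < K by rewrite ltr_wpDl// mulr_ge0.
set y := blockmul M z.
have := laplacian_form_ge0 a_ge0 a_sym (fun i => z i + (- K) *: y i).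
have -> : \sum_i dotv (z i + - K *: y i) (blockmul L (fun i => z i + - K *: y i) i) =
    \sum_i dotv (z i) (blockmul L z i) - 2 * K * \sum_i dotv (z i) (z i)
    + K ^+ 2 * \sum_i dotv (z i) (y i).
  under eq_bigr do rewrite blockmulD blockmulZ LMz !dotv_lin.
  have e : \sum_i dotv (y i) (blockmul L z i) = \sum_i dotv (z i) (z i).
    rewrite dotv_blockmul ?tr_laplacian//.
    by apply: eq_bigr => i _; rewrite LMz.
  have e' : \sum_i dotv (y i) (z i) = \sum_i dotv (z i) (y i).
    by apply: eq_bigr => i _; rewrite dotvC.
  by rewrite !big_split/= -!mulr_sumr e e'; ring.
have := laplacian_form_le a_ge0 a_sym z; rewrite -/T.
set S := \sum_i dotv (z i) (z i) => H1 H2.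
have S0 : 0 <= S by apply: sumr_ge0 => ? _; exact: dotv_ge0.
have KS : K * S = 2 * T * S + S by rewrite /K; ring.
rewrite -(ler_pM2l K0) mulrA -expr2; lra.
Qed.

End LaplacianInverse.

(** * Euclidean projection and the gradient inequality *)

Section Projection.
Context {R : realType}.

Lemma is_proj_var n (d : 'I_n -> nat) (X : forall i, set 'cV[R]_(d i)) (w x : stk R d) :
  (forall i, convex_setv (X i)) -> is_proj X w x ->
  forall i y, X i y -> dotv (w i - x i) (y - x i) <= 0.
Proof.
move=> cX [Xx px] i y Xy; rewrite leNgt; apply/negP => c0.
set c := dotv _ _ in c0; pose q := dotv (y - x i) (y - x i).
have q0 : 0 <= q by exact: dotv_ge0.
have D0 : 0 < q + 1 + c by lra.
(* Moving block [i] alone by a step [t] towards [y], minimality gives [2 c <= t q]; this step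
   satisfies [t q < c], a contradiction. *)
pose t := c / (q + 1 + c).
have tD : t * (q + 1 + c) = c by rewrite /t divfK// gt_eqF.
have t0 : 0 < t by rewrite divr_gt0.
have t1 : t <= 1 by rewrite ler_pdivrMr// mul1r; lra.
pose yt := dfwith x i (t *: y + (1 - t) *: x i).
have := px yt _; rewrite /stk_sqdist (bigD1 i)//= [X in _ -> _ <= X](bigD1 i)//=.
rewrite [X in _ -> _ + X <= _](eq_bigr (fun j => dotv (w j - yt j) (w j - yt j))); last first.
  by move=> j ji; rewrite /yt dfwithout// eq_sym.
rewrite lerD2r => H.
have {}H : prodset X yt -> 2 * c <= t * q.
  move=> /H; rewrite /yt dfwithin.
  have -> : w i - (t *: y + (1 - t) *: x i) = (w i - x i) - t *: (y - x i).
    by apply/colP => k; rewrite !mxE; ring.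
  move: (w i - x i) (y - x i) @c @q {c0 q0 D0 t1 tD yt H} @t t0 => u v c q t t0 H.
  rewrite -(ler_pM2l t0).
  move: H; rewrite !dotv_lin (dotvC v u) -/c -/q; lra.
suff /H : prodset X yt.
  have tq : t * q + t + t * c = c by rewrite -[RHS]tD; ring.
  have tc : 0 < t * c by exact: mulr_gt0.
  lra.
move=> j; have [<-|ij] := eqVneq i j; last by rewrite /yt dfwithout.
by rewrite /yt dfwithin; apply: cX => //; rewrite (ltW t0).
Qed.

Section ConvexProjection.
Variables (m : nat) (X : set 'cV[R]_m).
Definition var_proj (w x : 'cV[R]_m) := X x /\ forall y, X y -> dotv (w - x) (y - x) <= 0.

(** Firm nonexpansiveness: add the two variational inequalities, each tested at the other
    projection. *)
Lemma var_proj_contract w x w' x' : var_proj w x -> var_proj w' x' ->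
  dotv (x' - x) (x' - x) <= dotv (w' - w) (x' - x).
Proof.
move=> [Xx hx] [Xx' hx']; have := hx _ Xx'; have := hx' _ Xx.
have -> : x - x' = - (x' - x) by rewrite opprB.
have -> : w' - x' = (w - x) + (w' - w) - (x' - x).
  by apply/colP => k; rewrite !mxE; ring.
by rewrite !dotv_lin; lra.
Qed.

Lemma var_proj_nonexp w x w' x' : var_proj w x -> var_proj w' x' ->
  dotv (x' - x) (x' - x) <= dotv (w' - w) (w' - w).
Proof.
move=> h h'; have := var_proj_contract h h'.
by have := dotv_young (w' - w) (x' - x); lra.
Qed.

(** Both functions vanish at [t], so the difference quotient of [e] is dominated by that of [H]. *)
Lemma is_derive_squeeze (e H : R -> R) (t : R) :
  (\forall s \near t, `|e s| <= H s) -> H t = 0 -> is_derive t 1 H 0 -> is_derive t 1 e 0.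
Proof.
move=> eH Ht [dH DH].
have et : e t = 0 by have /nbhs_singleton := eH; rewrite Ht normr_le0 => /eqP.
suff c0 : h^-1 *: (e (h *: (1 : R) + t) - e t) @[h --> 0^'] --> (0 : R).
  by apply: DeriveDef; [exact: cvgP c0|exact: cvg_lim c0].
have {dH}/cvgrPdist_le Hc : h^-1 *: (H (h *: (1 : R) + t) - H t) @[h --> 0^'] --> (0 : R).
  by rewrite -[X in _ --> X]DH; exact: dH.
apply/cvgrPdist_le => r r0; near=> h.
have : `|0 - h^-1 *: (H (h *: (1 : R) + t) - H t)| <= r by near: h; exact: Hc.
rewrite !sub0r !normrN et Ht !subr0 !normrZ; apply: le_trans.
rewrite ler_wpM2l//; apply: le_trans (ler_norm _).
near: h; apply: nbhs_dnbhs.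
have ct : (fun h => h *: (1 : R) + t) @ (0 : R) --> t.
  rewrite -[X in _ --> X]add0r -[X in _ --> X + _](scale0r (1 : R)).
  by apply: cvgD; [apply: cvgZr_tmp|apply: cvg_cst].
exact: (ct _ eH).
Unshelve. all: by end_near. Qed.

(* Between [t] and [s], half the squared distance to [X] differs from
   [|w s - x t|^2 / 2] by at most [|w s - w t|^2 / 2], so [x] need not be differentiable. *)
Lemma is_derive_sqdist_proj (w x : R -> 'cV[R]_m) dw (t : R) :
  (forall s, 0 <= s -> var_proj (w s) (x s)) -> 0 < t -> is_derive t 1 w dw ->
  is_derive t 1 (fun s => dotv (w s - x s) (w s - x s)) (2 * dotv (w t - x t) dw).
Proof.
move=> hp t0 hw.
pose G s := dotv (w s - x t) (w s - x t).
pose H s := dotv (w s - w t) (w s - w t).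
pose e s := G s - dotv (w s - x s) (w s - x s).
have hc (c : 'cV[R]_m) : is_derive t 1 (fun s => w s - c) dw.
  by apply: is_derive_eq; rewrite subr0.
have hG : is_derive t 1 G (2 * dotv (w t - x t) dw).
  apply: is_derive_eq; first exact: is_derive_dotv (hc (x t)) (hc (x t)).
  by rewrite (dotvC dw); ring.
have hH : is_derive t 1 H 0.
  apply: is_derive_eq; first exact: is_derive_dotv (hc (w t)) (hc (w t)).
  by rewrite /= subrr dotv0l dotv0r addr0.
have he : is_derive t 1 e 0.
  apply: is_derive_squeeze hH; last by rewrite /H subrr dotv0l.
  near=> s.
  have s0 : 0 <= s by apply: ltW; near: s; exact: lt_nbhsr.
  have [Xs hs] := hp s s0; have [Xt ht] := hp t (ltW t0).
  (* Nonnegativity follows from the variational inequality at [s], the bound by [H s] from the one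
     at [t] together with Young's inequality. *)
  have E : e s = dotv (x s - x t) (x s - x t) - 2 * dotv (w s - x s) (x t - x s).
    rewrite /e /G !dotv_lin (dotvC (x s) (w s)) (dotvC (x t) (w s)) (dotvC (x t) (x s)).
    by ring.
  rewrite ger0_norm E; last first.
    by have := hs _ Xt; have := dotv_ge0 (x s - x t); lra.
  have := ht _ Xs; have := dotv_young (w s - w t) (x s - x t); rewrite /H !dotv_lin.
  rewrite ?(dotvC (x s) (w s), dotvC (x t) (w s), dotvC (x s) (w t), dotvC (x t) (w t)).
  by rewrite (dotvC (w t) (w s)) (dotvC (x t) (x s)); lra.
rewrite (_ : (fun s => _) = G - e); last first.
  by apply/funext => s; rewrite (_ : (G - e) s = G s - e s)// /e subKr.
by apply: is_derive_eq; rewrite subr0.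
Unshelve. all: by end_near. Qed.

End ConvexProjection.

Lemma diff_grad m (g : 'cV[R]_m -> R) x v : 'd g x v = dotv (grad g x) v.
Proof.
have e : v = \sum_k v k 0 *: (delta_mx k 0 : 'cV[R]_m).
  by rewrite [LHS]matrix_sum_delta; apply: eq_bigr => i _; rewrite big_ord1.
rewrite [in LHS]e linear_sum dotvE; apply: eq_bigr => k _.
by rewrite linearZ/= mxE mulrC.
Qed.

Lemma convex_grad_le m (X : set 'cV[R]_m) g x y : convex_on X g -> X x -> X y ->
  differentiable g x -> g x + dotv (grad g x) (y - x) <= g y.
Proof.
move=> cg Xx Xy dg; rewrite -diff_grad -deriveE//.
have /cvg_ex[/= l cl] := diff_derivable (v := y - x) dg.
have -> : 'D_(y - x) g x = l by apply: cvg_lim cl.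
rewrite -lerBrDl.
have cr : h^-1 *: (g (h *: (y - x) + x) - g x) @[h --> (0 : R)^'+] --> l.
  exact: cvg_dnbhs_at_right.
apply: (cvgr_to_le cr); near=> h.
have h0 : 0 < h by near: h; exact: nbhs_right_gt.
have h1 : h <= 1 by near: h; apply: nbhs_right_le.
rewrite /GRing.scale/= mulrC ler_pdivrMr//.
have -> : h *: (y - x) + x = h *: y + (1 - h) *: x.
  by apply/colP => k; rewrite !mxE; ring.
have := cg y x h Xy Xx; rewrite (ltW h0) h1 => /(_ isT); lra.
Unshelve. all: by end_near. Qed.

End Projection.

(** The constraints are the [p] coordinates of [A y - b], the convex function is the excess of [f]
    over its optimal value, and the Slater point is the internal point. *)
Lemma strong_duality (R : realType) n p (d : 'I_n -> nat)
    (f : forall i, 'cV[R]_(d i) -> R) (X : forall i, set 'cV[R]_(d i))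
    (A : forall i, 'M[R]_(p, d i)) (b : 'cV[R]_p) (xo : stk R d) :
  optimal f X A b xo -> (forall i, convex_setv (X i) /\ convex_on (X i) (f i)) ->
  (exists xs, rel_interior (prodset X) xs /\ stk_mul A xs = b) ->
  exists l : 'cV[R]_p, forall y, prodset X y ->
    \sum_i f i (xo i) <= \sum_i f i (y i) + dotv l (stk_mul A y - b).
Proof.
move=> [[Axo Xxo] xomin] cvx [xs [[Xxs [e [e0 he]]] Axs]].
pose comb t (x y : stk R d) : stk R d := fun i => t *: x i + (1 - t) *: y i.
pose h (y : stk R d) := \sum_i f i (y i) - \sum_i f i (xo i).
pose l (k : 'I_p) y := (stk_mul A y - b) k 0.
have [|||||y Xy ly|mu Hmu] := @lagrange_multipliers R (stk R d) comb p (prodset X) h l xs.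
- by move=> x y t Xx Xy t01 i; apply: (cvx i).1.
- move=> x y t Xx Xy t01; rewrite /h /comb.
  have -> : forall a b c : R, t * (a - c) + (1 - t) * (b - c) = t * a + (1 - t) * b - c.
    by move=> *; ring.
  rewrite lerD2r !mulr_sumr -big_split/=; apply: ler_sum => i _.
  exact: (cvx i).2.
- move=> k x y t; rewrite /l.
  have -> : stk_mul A (comb t x y) = t *: stk_mul A x + (1 - t) *: stk_mul A y.
    rewrite /stk_mul !scaler_sumr -big_split/=; apply: eq_bigr => i _.
    by rewrite mulmxDr -!scalemxAr.
  by rewrite !mxE; ring.
- split=> // y Xy.
  pose q := stk_sqdist y xs; have q0 : 0 <= q by apply: sumr_ge0 => i _; exact: dotv_ge0.
  (* Small enough that [s < e] and [s * q < e], so the affine prolongation [y'] of the segment past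
     [xs] lies within distance [e] of [xs]. *)
  pose s := e / (1 + q + e); have D : 0 < 1 + q + e by lra.
  have s0 : 0 < s by rewrite divr_gt0.
  have sD : s * (1 + q + e) = e by rewrite divfK// gt_eqF.
  have s1 : s < 1 by rewrite ltr_pdivrMr// mul1r; lra.
  pose y' : stk R d := fun i => (1 + s) *: xs i - s *: y i.
  exists y', (s / (1 + s)); have s10 : 0 < 1 + s by lra.
  split.
  + apply: he.
      exists 2%N, (fun j => if j == 0 then xs else y), (fun j => if j == 0 then 1 + s else - s).
      split; first by move=> j; case: ifP.
      by split; [rewrite !big_ord_recl big_ord0/=; ring|
        move=> i; rewrite !big_ord_recl big_ord0/= addr0 scaleNr].
    have -> : stk_sqdist xs y' = s ^+ 2 * q.
      rewrite /q /stk_sqdist mulr_sumr; apply: eq_bigr => i _.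
      have -> : xs i - y' i = s *: (y i - xs i).
        by apply/colP => k; rewrite !mxE; ring.
      by rewrite dotvZl dotvZr; ring.
    have sq : s * q < e by nra.
    by nra.
  + by rewrite divr_gt0//= ltr_pdivrMr// mul1r ltrDr.
  + apply: functional_extensionality_dep => i; apply/colP => k; rewrite !mxE.
    by field; rewrite gt_eqF.
- by move=> k; rewrite /l Axs subrr mxE.
- rewrite subr_ge0 xomin//; split => //; apply/colP => k.
  by have := ly k; rewrite /l !mxE => /eqP; rewrite subr_eq0 => /eqP.
exists (\col_k mu k) => y Xy; have := Hmu y Xy.
rewrite dotvE /h /l; under [X in _ -> _ <= _ + X]eq_bigr do rewrite mxE.
by lra.
Qed.

(* Bounded functions with increments controlled by [delta]: with
   [delta s t = |t - s|] these are the bounded Lipschitz functions on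
   [[1, +oo[], and with [delta = 1] just the bounded ones. *)
Section BoundedIncrements.
Context {R : realType}.
Variable delta : R -> R -> R.
Hypothesis delta_ge0 : forall s t, 0 <= delta s t.

Definition bincr (g : R -> R) := exists2 C, 0 <= C & forall t, 1 <= t ->
  `|g t| <= C /\ forall s, 1 <= s -> `|g t - g s| <= C * delta s t.

Definition bincrv m (u : R -> 'cV[R]_m) := forall k, bincr (fun t => u t k 0).

Lemma bincr_cst c : bincr (fun=> c).
Proof.
exists `|c| => // t _; split => // s _.
by rewrite subrr normr0 mulr_ge0.
Qed.

Lemma bincrD g h : bincr g -> bincr h -> bincr (fun t => g t + h t).
Proof.
move=> [C C0 gC] [D D0 hD]; exists (C + D); first exact: addr_ge0.
move=> t t1; have [g1 g2] := gC t t1; have [h1 h2] := hD t t1.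
split=> [|s s1]; first by rewrite (le_trans (ler_normD _ _))// lerD.
have -> : g t + h t - (g s + h s) = (g t - g s) + (h t - h s) by ring.
by rewrite mulrDl (le_trans (ler_normD _ _))// lerD// ?g2 ?h2.
Qed.

Lemma bincrM g h : bincr g -> bincr h -> bincr (fun t => g t * h t).
Proof.
move=> [C C0 gC] [D D0 hD]; exists (2 * C * D); first by rewrite !mulr_ge0.
move=> t t1; have [g1 g2] := gC t t1; have [h1 h2] := hD t t1.
split=> [|s s1].
  rewrite normrM (le_trans (ler_pM _ _ g1 h1))//.
  by rewrite ler_wpM2r// ler_peMl// ler1n.
have [_ _] := gC s s1.
have -> : g t * h t - g s * h s = (g t - g s) * h t + g s * (h t - h s) by ring.
rewrite (le_trans (ler_normD _ _))// !normrM.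
have -> : 2 * C * D * delta s t = C * delta s t * D + C * (D * delta s t) by ring.
by apply: lerD; apply: ler_pM => //; [exact: g2|case: (gC s s1)|exact: h2].
Qed.

Lemma bincr_sum (I : finType) (g : I -> R -> R) :
  (forall i, bincr (g i)) -> bincr (fun t => \sum_i g i t).
Proof.
move=> hg; rewrite /index_enum; elim: (locked_with _ _) => [|i s IH].
  rewrite (_ : (fun t => _) = fun=> 0); first exact: bincr_cst.
  by apply/funext => t; rewrite big_nil.
rewrite (_ : (fun t => _) = fun t => g i t + \sum_(j <- s) g j t); first exact: bincrD.
by apply/funext => t; rewrite big_cons.
Qed.

Lemma bincrZ c g : bincr g -> bincr (fun t => c * g t).
Proof. by move=> hg; apply: bincrM => //; exact: bincr_cst. Qed.

Lemma bincrv_cst m (c : 'cV[R]_m) : bincrv (fun=> c).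
Proof. by move=> k; exact: bincr_cst. Qed.

Lemma bincrvD m (u v : R -> 'cV[R]_m) :
  bincrv u -> bincrv v -> bincrv (fun t => u t + v t).
Proof.
move=> hu hv k; rewrite (_ : (fun t => _) = fun t => u t k 0 + v t k 0).
  exact: bincrD.
by apply/funext => t; rewrite mxE.
Qed.

Lemma bincrvZ m c (u : R -> 'cV[R]_m) : bincrv u -> bincrv (fun t => c *: u t).
Proof.
move=> hu k; rewrite (_ : (fun t => _) = fun t => c * u t k 0).
  exact: bincrZ.
by apply/funext => t; rewrite mxE.
Qed.

Lemma bincrvN m (u : R -> 'cV[R]_m) : bincrv u -> bincrv (fun t => - u t).
Proof.
move=> hu; rewrite (_ : (fun t => _) = fun t => (-1) *: u t); first exact: bincrvZ.
by apply/funext => t; rewrite scaleN1r.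
Qed.

Lemma bincrvB m (u v : R -> 'cV[R]_m) :
  bincrv u -> bincrv v -> bincrv (fun t => u t - v t).
Proof. by move=> hu hv; apply: bincrvD => //; exact: bincrvN. Qed.

Lemma bincrv_mulmx m q (A : 'M[R]_(q, m)) (u : R -> 'cV[R]_m) :
  bincrv u -> bincrv (fun t => A *m u t).
Proof.
move=> hu k; rewrite (_ : (fun t => _) = fun t => \sum_j A k j * u t j 0).
  by apply: bincr_sum => j; exact: bincrZ.
by apply/funext => t; rewrite mxE.
Qed.

Lemma bincrv_blockmul n m (B : 'M[R]_n) (u : R -> 'I_n -> 'cV[R]_m) i :
  (forall j, bincrv (fun t => u t j)) -> bincrv (fun t => blockmul B (u t) i).
Proof.
move=> hu k.
rewrite (_ : (fun t => _) = fun t => \sum_j B i j * u t j k 0).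
  by apply: bincr_sum => j; apply: bincrZ; exact: hu.
by apply/funext => t; rewrite summxE; apply: eq_bigr => j _; rewrite mxE.
Qed.

Lemma bincr_dotv m (u v : R -> 'cV[R]_m) :
  bincrv u -> bincrv v -> bincr (fun t => dotv (u t) (v t)).
Proof.
move=> hu hv; rewrite (_ : (fun t => _) = fun t => \sum_k u t k 0 * v t k 0).
  by apply: bincr_sum => k; exact: bincrM.
by apply/funext => t; rewrite dotvE.
Qed.

End BoundedIncrements.

Section BoundedLipschitz.
Context {R : realType}.
Definition bounded1 := bincr (fun _ _ : R => 1).
Definition bounded1v m := @bincrv R (fun _ _ : R => 1) m.
Definition boundedlip := bincr (fun s t : R => `|t - s|).
Definition boundedlipv m := @bincrv R (fun s t : R => `|t - s|) m.

Lemma bounded1P (g : R -> R) C : (forall t, 1 <= t -> `|g t| <= C) -> bounded1 g.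
Proof.
move=> gC; have C0 : 0 <= C by rewrite (le_trans _ (gC 1 (lexx _))).
exists (C + C); first exact: addr_ge0.
move=> t t1; split=> [|s s1]; first by rewrite (le_trans (gC t t1))// lerDl.
by rewrite mulr1 (le_trans (ler_normB _ _))// lerD// gC.
Qed.

Lemma bounded1v_dotv m (u : R -> 'cV[R]_m) C :
  (forall t, 1 <= t -> dotv (u t) (u t) <= C) -> bounded1v u.
Proof.
move=> uC k; apply: (@bounded1P _ (C + 1)) => t t1.
have := le_trans (sqr_coord_le_dotv (u t) k) (uC t t1).
rewrite -real_normK ?num_real// => H.
have : 0 <= (`|u t k 0| - 1) ^+ 2 by exact: sqr_ge0.
by have := normr_ge0 (u t k 0); nra.
Qed.

Lemma boundedlip_derive (g dg : R -> R) :
  (forall t : R, 0 < t -> is_derive t 1 g (dg t)) -> bounded1 g -> bounded1 dg ->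
  boundedlip g.
Proof.
move=> hg [C C0 gC] [D D0 gD]; exists (C + D); first exact: addr_ge0.
move=> t t1; split=> [|s s1]; first by rewrite (le_trans (gC t t1).1)// lerDl.
wlog st : s t s1 t1 / s < t.
  move=> H; have [st|ts|->] := ltgtP s t; first exact: H.
  - by rewrite distrC (distrC t); exact: H.
  - by rewrite subrr normr0 mulr_ge0// addr_ge0.
have [c /andP[sc ct] ->] := MVT_pos hg (lt_le_trans ltr01 s1) st.
rewrite normrM ler_wpM2r// (le_trans (gD c _).1) ?lerDr//.
by rewrite (le_trans s1) ?ltW.
Qed.

Lemma boundedlipv_derive m (u du : R -> 'cV[R]_m) :
  (forall t : R, 0 < t -> is_derive t 1 u (du t)) -> bounded1v u -> bounded1v du ->
  boundedlipv u.
Proof.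
move=> hu bu bdu k; apply: boundedlip_derive (bu k) (bdu k) => t t0.
by apply: (is_derive_coord k); exact: hu.
Qed.

(** Transfers the Lipschitz property from [w] to its projection [x], for which no derivative is
    available. *)
Lemma boundedlipv_nonexp m (w x : R -> 'cV[R]_m) : boundedlipv w -> bounded1v x ->
  (forall s t, 1 <= s -> 1 <= t ->
    dotv (x t - x s) (x t - x s) <= dotv (w t - w s) (w t - w s)) -> boundedlipv x.
Proof.
move=> hw bx hx k; have [D D0 xD] := bx k.
have /choice[C wC] j : exists C, 0 <= C /\ forall s t, 1 <= s -> 1 <= t ->
    `|w t j 0 - w s j 0| <= C * `|t - s|.
  by have [C C0 H] := hw j; exists C; split => // s t s1 t1; exact: (H t t1).2.
pose E := \sum_j C j ^+ 2; have E0 : 0 <= E by apply: sumr_ge0 => j _; exact: sqr_ge0.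
(* [E + 1] stands in for the square root of [E], since its square exceeds [E]. *)
exists (D + (E + 1)); first by lra.
move=> t t1; split=> [|s s1].
  by rewrite (le_trans (xD t t1).1)// lerDl; lra.
have H : `|x t k 0 - x s k 0| ^+ 2 <= E * `|t - s| ^+ 2.
  have -> : x t k 0 - x s k 0 = (x t - x s) k 0 by rewrite !mxE.
  rewrite (real_normK (num_real ((x t - x s) k 0))).
  apply: le_trans (sqr_coord_le_dotv _ _) _.
  rewrite (le_trans (hx s t s1 t1))// dotvE mulr_suml ler_sum// => j _.
  rewrite -expr2 -exprMn -real_normK ?num_real//.
  by rewrite lerXn2r ?nnegrE// ?mulr_ge0 ?(wC j).1// !mxE (wC j).2.
have S0 := normr_ge0 (t - s).
rewrite -(ler_pXn2r (ltn0Sn 1)) ?nnegrE ?mulr_ge0//; last by lra.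
rewrite (le_trans H)// exprMn ler_wpM2r ?sqr_ge0//.
by nra.
Qed.

End BoundedLipschitz.

Lemma is_derive_sumf {R : realType} n (h : 'I_n -> R -> R) dh (t : R) :
  (forall i, is_derive t 1 (h i) (dh i)) ->
  is_derive t 1 (fun s => \sum_i h i s) (\sum_i dh i).
Proof.
move=> hh; rewrite (_ : (fun s => _) = \sum_i h i); first exact: is_derive_sum.
by apply/funext => s; rewrite fct_sumE.
Qed.

Lemma is_derive_sqnorm {R : realType} m (u : R -> 'cV[R]_m) du (t : R) :
  is_derive t 1 u du -> is_derive t 1 (fun s => dotv (u s) (u s)) (2 * dotv (u t) du).
Proof.
move=> hu; apply: is_derive_eq; first exact: (is_derive_dotv hu hu).
by rewrite (dotvC du); ring.
Qed.

Lemma is_derive_blockform {R : realType} n p (B : 'M[R]_n) (u : R -> 'I_n -> 'cV[R]_p)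
    du (t : R) : B^T = B -> (forall i, is_derive t 1 (fun s => u s i) (du i)) ->
  is_derive t 1 (fun s => \sum_i dotv (u s i) (blockmul B (u s) i))
    (2 * \sum_i dotv (blockmul B (u t) i) (du i)).
Proof.
move=> BT hu; apply: is_derive_eq.
  apply: is_derive_sumf => i; apply: is_derive_dotv (hu i) _.
  exact: (@is_derive_lincomb _ _ _ _ (fun j s => u s j)).
rewrite big_split/= [X in _ + X](dotv_blockmul (u t) du BT).
under eq_bigr do rewrite dotvC.
by rewrite /= -/(blockmul _ _) mulr2n mulrDl mul1r.
Qed.

Lemma ler_norm_between {R : realType} (u v C D : R) :
  0 <= C -> 0 <= D -> u - v <= C -> v - u <= D -> `|u| <= `|v| + C + D.
Proof.
move=> C0 D0 h1 h2; rewrite ler_norml; have := ler_norm v; have := ler_norm (- v).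
by rewrite normrN => *; apply/andP; split; lra.
Qed.

(** For [u' = - k u + c], Young's inequality absorbs the forcing into half of the damping; this is
    the estimate that Gronwall's lemma takes for [|u|^2], multiplied by [k]. *)
Lemma dotv_descent {R : realType} m (k C : R) (u c : 'cV[R]_m) : dotv c c <= C ->
  k * (2 * (- k * dotv u u + dotv u c)) <= - k ^+ 2 * dotv u u + C.
Proof. by have := dotv_young (k *: u) c; rewrite !dotvZl dotvZr; lra. Qed.

(** * Analysis of a trajectory, with a fixed multiplier [l] and inverse [M] *)

Section Trajectory.
(* Otherwise the agent index of [f], [X], [A] would become implicit. *)
Unset Implicit Arguments.
Context {R : realType} {n p : nat} {d : 'I_n -> nat}.
Variables (f : forall i, 'cV[R]_(d i) -> R) (X : forall i, set 'cV[R]_(d i)).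
Variables (A : forall i, 'M[R]_(p, d i)) (b : 'cV[R]_p) (bs : 'I_n -> 'cV[R]_p).
Variables (a : 'M[R]_n) (alpha beta : R).
Variables (w : R -> stk R d) (lam z : R -> 'I_n -> 'cV[R]_p) (x : R -> stk R d).
Set Implicit Arguments.
Hypotheses (freg : forall i, agent_regular (X i) (f i)).
Hypotheses (a_ge0 : nonneg_adj a) (a_sym : undirected a).
Hypotheses (alpha_gt0 : 0 < alpha) (beta_gt0 : 0 < beta) (sum_bs : \sum_i bs i = b).
Hypotheses (traj : proj_idea_traj f X A bs a alpha beta w lam z x).
Hypotheses (z0 : \sum_i z 0 i = 0).
Variables (M : 'M[R]_n) (K : R).
Hypotheses (trM : M^T = M) (K_gt0 : 0 < K).
Local Notation L := (laplacian a).
Hypotheses (greenM : forall y : 'I_n -> 'cV[R]_p, \sum_i y i = 0 ->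
  blockmul L (blockmul M y) =1 y /\
  \sum_i dotv (y i) (y i) <= K * \sum_i dotv (y i) (blockmul M y i)).
Variables (l : 'cV[R]_p) (fopt : R).
Hypotheses (saddle : forall y, prodset X y ->
  fopt <= \sum_i f i (y i) + dotv l (stk_mul A y - b)).

Definition resid t i := A i *m x t i - bs i - z t i.
Definition dissent t i := blockmul L (lam t) i.
(** By [saddle], no feasible point has value below [fopt], so these points are optimal. *)
Definition attains (xs : stk R d) := feasible X A b xs /\ \sum_i f i (xs i) = fopt.
Definition zstar (xs : stk R d) i := A i *m xs i - bs i.
(** The excess of the Lagrangian at the multiplier [l] over the optimal value; unlike the excess of
    [f], it is nonnegative at infeasible points of [X] as well. *)
Definition gap (y : stk R d) := \sum_i f i (y i) - fopt + dotv l (stk_mul A y - b).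

Lemma traj_proj t i : 0 <= t -> var_proj (X i) (w t i) (x t i).
Proof.
move=> t0; have [hp _] := traj; have := hp t t0 => H; split; first exact: H.1.
by apply: is_proj_var H i => j; have [_ []] := freg j.
Qed.

Lemma sum_zstar xs : attains xs -> \sum_i zstar xs i = 0.
Proof.
by move=> [[Axs _] _]; rewrite sumrB sum_bs; apply/eqP; rewrite subr_eq0; apply/eqP.
Qed.

Lemma sum_z t : 0 <= t -> \sum_i z t i = 0.
Proof.
have [_ [_ [_ [cz hd]]]] := traj.
pose S k t := \sum_i z t i k 0.
have dS k (t' : R) : 0 < t' -> is_derive t' 1 (S k) 0.
  move=> t0; apply: is_derive_eq.
    apply: is_derive_sumf => i; have [_ [_ h]] := hd t' t0 i.
    exact: is_derive_coord h.
  rewrite -summxE -scaler_sumr (eq_bigr (blockmul L (lam t'))) => [|i _ //].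
  by rewrite sum_laplacian// scaler0 mxE.
have cS k (s t' : R) : 0 < s -> s < t' -> S k t' = S k s.
  move=> s0 st; have [c _ /eqP] := MVT_pos (dS k) s0 st.
  by rewrite mul0r subr_eq0 => /eqP.
have cS1 k (s : R) : 0 < s -> S k s = S k 1.
  by move=> s0; have [s1|s1|->//] := ltgtP s 1; [rewrite -(cS k s 1)|rewrite (cS k 1 s)].
(* The equations hold only for positive times, so the initial value is reached through continuity
   from the right at 0. *)
have S1 k : S k 1 = 0.
  have c1 : S k s @[s --> (0 : R)^'+] --> S k 1.
    apply: cvg_near_cst; near=> s; apply: cS1.
    by near: s; exact: nbhs_right_gt.
  have c0 : S k s @[s --> (0 : R)^'+] --> S k 0.
    apply: cvg_sum_fin => i; apply: cvg_coord.
    have := cz i 0; rewrite /continuous_at.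
    have -> : nbhs (0 : subspace [set t : R | 0 <= t]) = within [set t : R | 0 <= t] (nbhs (0 : R)).
      by rewrite nbhs_subspace_in//=.
    move=> h; apply: cvg_trans h; apply: cvg_app.
    apply: within_subset => s /=; exact: ltW.
  have := cvg_unique _ c1 c0 => /(_ _) ->//.
  by rewrite /S -summxE z0 mxE.
move=> t0; have [->//|tn0] := eqVneq t 0.
apply/colP => k; rewrite summxE mxE -[LHS]/(S k t) cS1 ?S1//.
by rewrite lt_neqAle eq_sym tn0.
Unshelve. all: by end_near. Qed.

Lemma gap_ge0 y : prodset X y -> 0 <= gap y.
Proof. by move/saddle; rewrite /gap; lra. Qed.

Lemma gap_diff xs y : attains xs ->
  gap y = \sum_i (f i (y i) - f i (xs i) + dotv (A i *m (y i - xs i)) l).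
Proof.
move=> [[Axs _] fxs]; rewrite /gap -fxs -Axs big_split sumrB/=; congr (_ + _).
rewrite -dotv_suml dotvC; congr dotv.
by rewrite -sumrB; apply: eq_bigr => i _; rewrite mulmxBr.
Qed.

(** * The Lyapunov function and its decrease *)

Definition zerr xs (zz : 'I_n -> 'cV[R]_p) i := zz i - zstar xs i.

(** The state is an argument, so that the function can also be evaluated at limit states. The
    combination [z + alpha lam] has derivative [alpha *: resid], its Laplacian parts cancelling. In
    the [M] term, the Laplacian in the equation of [z] is inverted, leaving the pairing of [zerr]
    with [alpha (lam - l)]. The last term supplies the damping of [L lam]. *)
Definition lyap xs (ww xx : stk R d) (ll zz : 'I_n -> 'cV[R]_p) :=
  \sum_i (2^-1 * (dotv (ww i - xs i) (ww i - xs i) - dotv (ww i - xx i) (ww i - xx i))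
     + (2 * alpha)^-1 *
       dotv (zerr xs zz i + alpha *: (ll i - l)) (zerr xs zz i + alpha *: (ll i - l)))
  + (2 * beta)^-1 * \sum_i dotv (zerr xs zz i) (blockmul M (zerr xs zz) i)
  + beta / 2 * \sum_i dotv (ll i) (blockmul L ll i).

Definition lyap_t xs t := lyap xs (w t) (x t) (lam t) (z t).

Definition diss xs t :=
  \sum_i (alpha * dotv (x t i - xs i) (w t i - x t i) + 2^-1 * dotv (resid t i) (resid t i)
    + beta ^+ 2 / 2 * dotv (dissent t i) (dissent t i)) + alpha * gap (x t).

Definition dwt t i := - alpha *: (w t i - x t i + grad (f i) (x t i) + (A i)^T *m lam t i)
        - (A i)^T *m resid t i.
Definition dlamt t i := resid t i - beta *: dissent t i.
Definition dzt t i := (alpha * beta) *: dissent t i.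

Definition dlyap xs t :=
  \sum_i (dotv (w t i - xs i) (dwt t i) - dotv (w t i - x t i) (dwt t i)
    + dotv (zerr xs (z t) i + alpha *: (lam t i - l)) (resid t i))
  + beta^-1 * \sum_i dotv (blockmul M (zerr xs (z t)) i) (dzt t i)
  + beta * \sum_i dotv (blockmul L (lam t) i) (dlamt t i).

Lemma is_derive_lyap xs (t : R) : 0 < t -> is_derive t 1 (lyap_t xs) (dlyap xs t).
Proof.
move=> t0; have [_ [_ [_ [_ hd]]]] := traj.
have hw i : is_derive t 1 (fun s => w s i) (dwt t i) by have [] := hd t t0 i.
have hl i : is_derive t 1 (fun s => lam s i) (dlamt t i) by have [_ []] := hd t t0 i.
have hz i : is_derive t 1 (fun s => z s i) (dzt t i) by have [_ []] := hd t t0 i.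
have h1 i : is_derive t 1 (fun s => dotv (w s i - xs i) (w s i - xs i))
    (2 * dotv (w t i - xs i) (dwt t i)).
  by apply: (is_derive_sqnorm (u := fun s => w s i - xs i)); apply: is_derive_eq; rewrite subr0.
have h2 i : is_derive t 1 (fun s => dotv (w s i - x s i) (w s i - x s i))
    (2 * dotv (w t i - x t i) (dwt t i)).
  apply: (is_derive_sqdist_proj (X := X i) (w := fun s => w s i) (x := fun s => x s i)) => // s s0.
  exact: traj_proj.
have hze i : is_derive t 1 (fun s => zerr xs (z s) i) (dzt t i).
  by apply: is_derive_eq; rewrite subr0.
have h3 i : is_derive t 1 (fun s => dotv (zerr xs (z s) i + alpha *: (lam s i - l))
     (zerr xs (z s) i + alpha *: (lam s i - l)))
    (2 * dotv (zerr xs (z t) i + alpha *: (lam t i - l)) (alpha *: resid t i)).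
  apply: (is_derive_sqnorm (u := fun s => zerr xs (z s) i + alpha *: (lam s i - l))).
  apply: is_derive_eq.
  by rewrite subr0 /dzt /dlamt scalerBr !scalerA addrC subrK.
have h4 := is_derive_blockform trM hze.
have h5 := is_derive_blockform (tr_laplacian a_sym) hl.
have hs := is_derive_sumf (fun i => is_deriveD
  (is_deriveZ 2^-1 (is_deriveB (h1 i) (h2 i))) (is_deriveZ (2 * alpha)^-1 (h3 i))).
have H := is_deriveD (is_deriveD hs (is_deriveZ (2 * beta)^-1 h4)) (is_deriveZ (beta / 2) h5).
apply: is_derive_eq H _; rewrite /GRing.scale/= /dlyap; congr (_ + _ + _).
- apply: eq_bigr => i _; rewrite dotvZr; field; rewrite gt_eqF//.
- by rewrite mulrA; congr (_ * _); field; rewrite gt_eqF.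
- by rewrite mulrA; congr (_ * _); field.
Qed.

(* The cross terms in [lam - l] and [z] cancel because [blockmul M] inverts the Laplacian. *)
Lemma dlyap_le xs (t : R) : attains xs -> 0 < t -> dlyap xs t <= - diss xs t.
Proof.
move=> hxs t0.
have zt : \sum_i zerr xs (z t) i = 0 by rewrite sumrB sum_z ?ltW// sum_zstar// subrr.
have [LMz _] := greenM zt.
have e1 : \sum_i dotv (blockmul M (zerr xs (z t)) i) (dzt t i) =
    alpha * beta * \sum_i dotv (zerr xs (z t) i) (lam t i - l).
  rewrite /dzt; under eq_bigr do rewrite dotvZr.
  rewrite -mulr_sumr (dotv_blockmul _ _ (tr_laplacian a_sym)).
  under eq_bigr do rewrite LMz; congr (_ * _).
  under [RHS]eq_bigr do rewrite dotvDr; rewrite big_split/=.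
  by rewrite -dotv_suml zt dotv0l addr0.
rewrite /dlyap e1 mulrA (mulrCA beta^-1) mulVf ?gt_eqF// mulr1 !mulr_sumr -!big_split/=.
rewrite /diss (gap_diff _ hxs) mulr_sumr -big_split/= -sumrN; apply: ler_sum => i _.
have gr : f i (x t i) - f i (xs i) <= dotv (x t i - xs i) (grad (f i) (x t i)).
  have [_ [_ [cf [U [_ [XU [dU _]]]]]]] := freg i.
  have Xx : X i (x t i) by have [] := traj_proj i (ltW t0).
  have := convex_grad_le (y := xs i) cf Xx (hxs.1.2 i) (dU _ (XU _ Xx)).
  rewrite -(opprB (x t i)) dotvNr dotvC; lra.
have az : zerr xs (z t) i = A i *m (x t i - xs i) - resid t i.
  rewrite /zerr /zstar /resid mulmxBr.
  by apply/colP => k; rewrite !mxE; ring.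
have xd : dotv (w t i - xs i) (dwt t i) - dotv (w t i - x t i) (dwt t i) =
    dotv (x t i - xs i) (dwt t i).
  by rewrite -dotvNl -dotvDl; congr dotv; apply/colP => k; rewrite !mxE; ring.
rewrite xd {}az /dwt /dlamt -/(dissent t i).
move: (x t i - xs i) gr => u gr.
rewrite !(dotvDr u) !dotvNr !(dotvZr _ u) !(dotvDr u) !dotv_trmx.
(* The remaining cross term [beta <resid, dissent>] costs half of each square; hence the factors 1/2
   in [diss]. *)
have := dotv_young (resid t i) (beta *: dissent t i).
move: (ler_wpM2l (ltW alpha_gt0) gr) => {}gr.
move: (A i *m u) (resid t i) (dissent t i) (lam t i) => v r q lm.
rewrite !dotv_lin (dotvC lm r) (dotvC l r) (dotvC q r) => ?; lra.
Qed.

Lemma proj_gap_ge0 xs t i : attains xs -> 0 <= t -> 0 <= dotv (x t i - xs i) (w t i - x t i).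
Proof.
move=> hxs t0; have [_ H] := traj_proj i t0; have := H _ (hxs.1.2 i).
by rewrite -(opprB (x t i) (xs i)) dotvNr dotvC oppr_le0.
Qed.

Lemma gap_x_ge0 t : 0 <= t -> 0 <= gap (x t).
Proof. by move=> t0; apply: gap_ge0 => i; have [] := traj_proj i t0. Qed.

Lemma diss_ge xs t : attains xs -> 0 <= t ->
  [/\ forall i, alpha * dotv (x t i - xs i) (w t i - x t i) <= diss xs t,
   forall i, 2^-1 * dotv (resid t i) (resid t i) <= diss xs t,
   forall i, beta ^+ 2 / 2 * dotv (dissent t i) (dissent t i) <= diss xs t,
   alpha * gap (x t) <= diss xs t & 0 <= diss xs t].
Proof.
move=> hxs t0; pose T1 i := alpha * dotv (x t i - xs i) (w t i - x t i).
pose T2 i := 2^-1 * dotv (resid t i) (resid t i).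
pose T3 i := beta ^+ 2 / 2 * dotv (dissent t i) (dissent t i).
have T10 i : 0 <= T1 i by rewrite mulr_ge0 ?(ltW alpha_gt0)// proj_gap_ge0.
have T20 i : 0 <= T2 i by rewrite mulr_ge0 ?dotv_ge0.
have T30 i : 0 <= T3 i by rewrite mulr_ge0 ?dotv_ge0// divr_ge0// sqr_ge0.
have g0 : 0 <= alpha * gap (x t) by rewrite mulr_ge0 ?(ltW alpha_gt0)// gap_x_ge0.
have S0 : 0 <= \sum_i (T1 i + T2 i + T3 i) by apply: sumr_ge0 => i _; rewrite !addr_ge0.
have Si i : T1 i + T2 i + T3 i <= \sum_i (T1 i + T2 i + T3 i).
  by rewrite (bigD1 i)//= lerDl sumr_ge0// => j _; rewrite !addr_ge0.
rewrite /diss -/(\sum_i (T1 i + T2 i + T3 i)).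
split=> [i|i|i||]; rewrite -?/(T1 _) -?/(T2 _) -?/(T3 _).
- by have := Si i; have := T20 i; have := T30 i; rewrite -/(T1 i); lra.
- by have := Si i; have := T10 i; have := T30 i; rewrite -/(T2 i); lra.
- by have := Si i; have := T10 i; have := T20 i; rewrite -/(T3 i); lra.
- by lra.
- by rewrite addr_ge0.
Qed.

(** The first bracket equals [|x - xs|^2 / 2 + <x - xs, w - x>], whose pairing is nonnegative by the
    projection inequality; the [M] term is bounded below through [K]. Nothing here bounds [w]. *)
Lemma lyap_ge xs t : attains xs -> 0 <= t ->
  \sum_i (2^-1 * dotv (x t i - xs i) (x t i - xs i) + (2 * alpha)^-1 *
      dotv (zerr xs (z t) i + alpha *: (lam t i - l)) (zerr xs (z t) i + alpha *: (lam t i - l)))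
  + (2 * beta * K)^-1 * \sum_i dotv (zerr xs (z t) i) (zerr xs (z t) i) <= lyap_t xs t.
Proof.
move=> hxs t0; rewrite /lyap_t /lyap -[X in X <= _]addr0 lerD//; last first.
  by rewrite mulr_ge0 ?laplacian_form_ge0// divr_ge0// ltW.
apply: lerD.
  apply: ler_sum => i _; rewrite lerD2r ler_wpM2l//.
  have := proj_gap_ge0 i hxs t0.
  have -> : w t i - xs i = (w t i - x t i) + (x t i - xs i).
    by apply/colP => k; rewrite !mxE; ring.
  by move: (x t i - xs i) (w t i - x t i) => u v; rewrite !dotv_lin (dotvC v u); lra.
have zt : \sum_i zerr xs (z t) i = 0 by rewrite sumrB sum_z// sum_zstar// subrr.
rewrite invfM -mulrA ler_wpM2l ?invr_ge0 ?mulr_ge0 ?(ltW beta_gt0)//.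
by rewrite ler_pdivrMl// (greenM zt).2.
Qed.

Lemma lyap_ge0 xs t : attains xs -> 0 <= t -> 0 <= lyap_t xs t.
Proof.
move=> hxs t0; apply: le_trans (lyap_ge hxs t0).
apply: addr_ge0.
  by apply: sumr_ge0 => i _; rewrite addr_ge0// mulr_ge0 ?dotv_ge0// invr_ge0 mulr_ge0// ltW.
rewrite mulr_ge0 ?invr_ge0 ?mulr_ge0 ?(ltW K_gt0) ?(ltW beta_gt0)//.
by apply: sumr_ge0 => i _; exact: dotv_ge0.
Qed.

Lemma lyap_nincr xs s t : attains xs -> 0 < s -> s <= t -> lyap_t xs t <= lyap_t xs s.
Proof.
move=> hxs s0 st; apply: (nonincreasing_pos (@is_derive_lyap xs)) s0 st => r r0.
rewrite (le_trans (dlyap_le hxs r0))// oppr_le0.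
by have [] := diss_ge hxs (ltW r0).
Qed.

(** * Boundedness and Lipschitz estimates along the trajectory *)

Lemma state_bounded xs : attains xs -> [/\ forall i, bounded1v (fun t => x t i),
  forall i, bounded1v (fun t => z t i) & forall i, bounded1v (fun t => lam t i)].
Proof.
move=> hxs; pose C := lyap_t xs 1.
have H t : 1 <= t -> forall i,
   [/\ 2^-1 * dotv (x t i - xs i) (x t i - xs i) <= C,
     (2 * alpha)^-1 * dotv (zerr xs (z t) i + alpha *: (lam t i - l))
       (zerr xs (z t) i + alpha *: (lam t i - l)) <= C &
     (2 * beta * K)^-1 * dotv (zerr xs (z t) i) (zerr xs (z t) i) <= C].
  move=> t1 i; have t0 : 0 <= t by rewrite (le_trans _ t1).
  have := le_trans (lyap_ge hxs t0) (lyap_nincr hxs ltr01 t1).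
  set T1 := fun i => 2^-1 * dotv (x t i - xs i) (x t i - xs i).
  set T2 := fun i => (2 * alpha)^-1 * dotv (zerr xs (z t) i + alpha *: (lam t i - l))
       (zerr xs (z t) i + alpha *: (lam t i - l)).
  set T3 := fun i => (2 * beta * K)^-1 * dotv (zerr xs (z t) i) (zerr xs (z t) i).
  have T10 j : 0 <= T1 j by rewrite mulr_ge0 ?dotv_ge0.
  have T20 j : 0 <= T2 j by rewrite mulr_ge0 ?dotv_ge0// invr_ge0 mulr_ge0// ltW.
  have T30 j : 0 <= T3 j by rewrite mulr_ge0 ?dotv_ge0// invr_ge0 !mulr_ge0// ltW.
  rewrite -/(\sum_i (T1 i + T2 i)) mulr_sumr -/(\sum_i T3 i) -big_split/= => HC.
  have : T1 i + T2 i + T3 i <= C.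
    apply: le_trans HC; rewrite (bigD1 i)//= lerDl sumr_ge0// => j _.
    by rewrite !addr_ge0.
  by rewrite -/(T1 i) -/(T2 i) -/(T3 i); have := T10 i; have := T20 i; have := T30 i; split; lra.
have ge01 (s t : R) : 0 <= (1 : R) by [].
have bx i : bounded1v (fun t => x t i - xs i).
  apply: (@bounded1v_dotv _ _ _ (2 * C)) => t t1.
  by have [+ _ _] := H t t1 i; rewrite ler_pdivrMl.
have bz i : bounded1v (fun t => zerr xs (z t) i).
  apply: (@bounded1v_dotv _ _ _ ((2 * beta * K) * C)) => t t1.
  by have [_ _] := H t t1 i; rewrite ler_pdivrMl// !mulr_gt0.
have bm i : bounded1v (fun t => zerr xs (z t) i + alpha *: (lam t i - l)).
  apply: (@bounded1v_dotv _ _ _ ((2 * alpha) * C)) => t t1.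
  by have [_ + _] := H t t1 i; rewrite ler_pdivrMl// !mulr_gt0.
split=> i.
- rewrite (_ : (fun t => _) = fun t => x t i - xs i + xs i).
    by apply: bincrvD; [exact: bx|exact: bincrv_cst].
  by apply/funext => t; rewrite subrK.
- rewrite (_ : (fun t => _) = fun t => zerr xs (z t) i + zstar xs i).
    by apply: bincrvD; [exact: bz|exact: bincrv_cst].
  by apply/funext => t; rewrite subrK.
(* [lam] is bounded only through the mixed variable, from which the bounded [zerr] is subtracted. *)
- rewrite (_ : (fun t => _) = fun t => alpha^-1 *:
     (zerr xs (z t) i + alpha *: (lam t i - l) - zerr xs (z t) i) + l).
    apply: bincrvD; last exact: bincrv_cst.
    by apply: bincrvZ => //; apply: bincrvB => //; [exact: bm|exact: bz].
  by apply/funext => t; rewrite addrAC subrr add0r scalerA mulVf ?gt_eqF// scale1r subrK.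
Qed.

(* A locally Lipschitz gradient is bounded near each limit point, hence along an
   ultrafilter on which its norm would tend to infinity. *)
Lemma grad_bounded i : bounded1v (fun t => x t i) -> bounded1v (fun t => grad (f i) (x t i)).
Proof.
move=> bx; pose g t := grad (f i) (x t i).
suff [C HC] : exists C, forall t, 1 <= t -> dotv (g t) (g t) <= C.
  exact: bounded1v_dotv HC.
apply: contrapT => unb.
have ex N : exists t, 1 <= t /\ N < dotv (g t) (g t).
  apply: contrapT => nex; apply: unb; exists N => t t1.
  by rewrite leNgt; apply/negP => gN; apply: nex; exists t.
pose B (N : R) := [set t | 1 <= t /\ N < dotv (g t) (g t)].
have FB : ProperFilter (filter_from setT B).
  apply: filter_from_proper => [|N _]; last exact: ex.
  apply: filter_from_filter; first by exists 0.
  move=> N N' _ _; exists (Num.max N N') => // t [t1].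
  by rewrite gt_max => /andP[].
have [F [FU BF]] := ultraFilterLemma FB.
have FN N : F (B N) by apply: BF; exists N.
have F1 : F [set t | 1 <= t] by apply: filterS (FN 0) => t [].
have [C C0 Cx] : exists2 C, 0 <= C & forall t, 1 <= t -> forall k, `|x t i k 0| <= C.
  have /choice[C HC] k : exists C, 0 <= C /\ forall t, 1 <= t -> `|x t i k 0| <= C.
    by have [C C0 H] := bx k; exists C; split => // t /H[].
  exists (\sum_k C k) => [|t t1 k]; first by apply: sumr_ge0 => k _; exact: (HC k).1.
  rewrite (le_trans ((HC k).2 t t1))// (bigD1 k)//= lerDl sumr_ge0// => j _.
  exact: (HC j).1.
have [y xy] : exists y : 'cV[R]_(d i), x t i @[t --> F] --> y.
  apply: (ultra_bounded_cvg_col (C := C)).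
  by apply: filterS F1 => t t1 k; exact: Cx.
have [clX [_ [_ [U [_ [XU [_ lipU]]]]]]] := freg i.
have Xx t : 1 <= t -> X i (x t i).
  by move=> t1; have [] := @traj_proj t i (le_trans ler01 t1).
have Xy : X i y.
  apply: (closed_cvg (X i) clX _ y xy).
  by apply: filterS F1 => t; exact: Xx.
have [r [Lc [r0 lipy]]] := lipU y (XU _ Xy).
have d0 : dotv (x t i - y) (x t i - y) @[t --> F] --> (0 : R).
  rewrite -(dotv0l (0 : 'cV[R]_(d i))); apply: cvg_dotv;
  by rewrite -(subrr y); apply: cvgB => //; exact: cvg_cst.
have Fr : F [set t | dotv (x t i - y) (x t i - y) < r ^+ 2].
  have r20 : 0 < r ^+ 2 by rewrite exprn_gt0.
  exact: (cvgr_lt _ d0 _ r20).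
(* The bound on the squared gradient norm that the Lipschitz estimate gives in the ball of radius
   [r] around [y]; a time in [B N] at which [x] is in this ball contradicts it. *)
pose N := 2 * (Lc ^+ 2 * r ^+ 2) + 2 * dotv (grad (f i) y) (grad (f i) y).
have [t [[[t1 gt] dt] ]] := filter_ex (filterI (filterI (FN N) Fr) F1).
move=> _; move: gt; rewrite ltNge => /negP; apply.
have et : enorm (x t i - y) < r.
  by rewrite /enorm -(ger0_norm (ltW r0)) -sqrtr_sqr ltr_sqrt// exprn_gt0.
have ey : enorm (y - y) < r by rewrite subrr /enorm dotv0l sqrtr0.
have := lipy _ _ (XU _ (Xx t t1)) (XU _ Xy) et ey; rewrite -/(g t) /enorm => H.
have {}H : dotv (g t - grad (f i) y) (g t - grad (f i) y) <= Lc ^+ 2 * r ^+ 2.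
  rewrite -(sqr_sqrtr (dotv_ge0 (g t - grad (f i) y))).
  apply: (@le_trans _ _ ((Lc * Num.sqrt (dotv (x t i - y) (x t i - y))) ^+ 2)).
    by rewrite lerXn2r ?nnegrE ?sqrtr_ge0// (le_trans _ H)// sqrtr_ge0.
  by rewrite exprMn sqr_sqrtr ?dotv_ge0// ler_wpM2l ?sqr_ge0// ltW.
by rewrite (le_trans (dotv_le_diff _ (grad (f i) y)))// lerD2r ler_wpM2l.
Qed.

Lemma resid_incr (delta : R -> R -> R) i : (forall s t, 0 <= delta s t) ->
  bincrv delta (fun t => x t i) -> bincrv delta (fun t => z t i) ->
  bincrv delta (fun t => resid t i).
Proof.
move=> d0 bx bz; apply: bincrvB => //; apply: bincrvB => //.
  exact: bincrv_mulmx.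
exact: bincrv_cst.
Qed.

Lemma w_bounded i : bounded1v (fun t => x t i) -> bounded1v (fun t => z t i) ->
  bounded1v (fun t => lam t i) -> bounded1v (fun t => w t i).
Proof.
move=> bx bz bl.
have d0 (s t : R) : 0 <= (1 : R) by [].
pose c t := alpha *: (x t i - grad (f i) (x t i) - (A i)^T *m lam t i)
   - (A i)^T *m resid t i.
have dwE t : dwt t i = - alpha *: w t i + c t.
  by apply/colP => k; rewrite /dwt /c; move: (resid t i) => r; rewrite !mxE; ring.
have bc : bounded1v c.
  apply: bincrvB => //; last by apply: bincrv_mulmx => //; exact: resid_incr.
  apply: bincrvZ => //; apply: bincrvB => //; last exact: bincrv_mulmx.
  by apply: bincrvB => //; exact: grad_bounded.
have [C C0 HC] := bincr_dotv d0 bc bc.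
have [_ [_ [_ [_ hd]]]] := traj.
have hV (t : R) : 0 < t ->
    is_derive t 1 (fun s => dotv (w s i) (w s i)) (2 * dotv (w t i) (dwt t i)).
  move=> t0; apply: (is_derive_sqnorm (u := fun s => w s i)).
  by have [] := hd t t0 i.
(* Gronwall's bound with rate [alpha] and constant term [alpha^-1 * C], which [dotv_descent] yields
   after division by [alpha]. *)
apply: (@bounded1v_dotv _ _ _ (`|dotv (w 1 i) (w 1 i)| + alpha^-1 * C / alpha)) => t t1.
apply: (gronwall_bounded hV alpha_gt0) t t1.
  by rewrite mulr_ge0// invr_ge0 ltW.
move=> t t1; have := (HC t t1).1; rewrite ger0_norm ?dotv_ge0// => cC.
rewrite dwE dotvDr dotvZr -(ler_pM2l alpha_gt0).
have -> : alpha * (- alpha * dotv (w t i) (w t i) + alpha^-1 * C) =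
    - alpha ^+ 2 * dotv (w t i) (w t i) + C.
  by rewrite mulrDr mulrA mulVKf ?gt_eqF//; ring.
exact: dotv_descent.
Qed.

Lemma state_lip xs : attains xs -> [/\ forall i, boundedlipv (fun t => x t i),
  forall i, boundedlipv (fun t => z t i), forall i, boundedlipv (fun t => lam t i) &
  forall i, boundedlipv (fun t => w t i)].
Proof.
move=> hxs; have [bx bz bl] := state_bounded hxs.
have d0 (s t : R) : 0 <= (1 : R) by [].
have bw i := w_bounded (bx i) (bz i) (bl i).
have [_ [_ [_ [_ hd]]]] := traj.
have br i : bounded1v (fun t => resid t i) := resid_incr d0 (bx i) (bz i).
have bq i : bounded1v (fun t => dissent t i) := bincrv_blockmul d0 _ _ bl.
have lw i : boundedlipv (fun t => w t i).
  apply: (@boundedlipv_derive _ _ (fun t => w t i) (fun t => dwt t i)) => //.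
    by move=> t t0; have [] := hd t t0 i.
  apply: (bincrvB d0); last exact: (bincrv_mulmx d0 _ (br i)).
  apply: (bincrvZ d0); apply: bincrvD; last exact: (bincrv_mulmx d0 _ (bl i)).
  by apply: bincrvD; [exact: (bincrvB d0 (bw i) (bx i))|exact: grad_bounded].
split=> // i.
- apply: (boundedlipv_nonexp (lw i) (bx i)) => s t s1 t1.
  by apply: (var_proj_nonexp (X := X i)); apply: traj_proj; rewrite (le_trans ler01).
- apply: (@boundedlipv_derive _ _ (fun t => z t i) (fun t => dzt t i)) => //.
    by move=> t t0; have [_ []] := hd t t0 i.
  exact: (bincrvZ d0 _ (bq i)).
- apply: (@boundedlipv_derive _ _ (fun t => lam t i) (fun t => dlamt t i)) => //.
    by move=> t t0; have [_ []] := hd t t0 i.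
  exact: (bincrvB d0 (br i) (bincrvZ d0 _ (bq i))).
Qed.

(** Both an increment and its opposite are bounded by the gradient inequality taken at a trajectory
    point, where gradients are bounded; no estimate between the two points is needed. Boundedness
    comes from comparison with [xs]. *)
Lemma f_lip xs i : attains xs -> boundedlip (fun t => f i (x t i)).
Proof.
move=> hxs; have [lx _ _ _] := state_lip hxs; have [bx _ _] := state_bounded hxs.
have d0 (s t : R) : 0 <= (1 : R) by [].
have bg := grad_bounded (bx i).
have [_ [_ [cf [U [_ [XU [dU _]]]]]]] := freg i.
have Xx t : 1 <= t -> X i (x t i).
  by move=> t1; have [] := @traj_proj t i (le_trans ler01 t1).
have Xs := hxs.1.2 i.
have grd u v : X i u -> X i v -> f i u - f i v <= dotv (grad (f i) u) (u - v).
  move=> Xu Xv; have := convex_grad_le cf Xu Xv (dU _ (XU _ Xu)).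
  by rewrite -(opprB u v) dotvNr lerBlDr addrC -lerBlDr addrC.
have bxs : bounded1v (fun t => x t i - xs i) := bincrvB d0 (bx i) (bincrv_cst d0 _).
have [C C0 HC] := bincr_dotv d0 bg bxs.
have [D D0 HD] := bincr_dotv d0 (bincrv_cst d0 (grad (f i) (xs i))) bxs.
have /choice[G HG] k : exists G, 0 <= G /\ forall t, 1 <= t -> `|grad (f i) (x t i) k 0| <= G.
  by have [E E0 HE] := bg k; exists E; split => // t /HE[].
have /choice[E HE] k : exists E, 0 <= E /\ forall s t, 1 <= s -> 1 <= t ->
    `|x t i k 0 - x s i k 0| <= E * `|t - s|.
  by have [E E0 HE] := lx i k; exists E; split => // s t s1 t1; exact: (HE t t1).2.
pose S := \sum_k G k * E k.
have S0 : 0 <= S by apply: sumr_ge0 => k _; rewrite mulr_ge0 ?(HG k).1 ?(HE k).1.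
have lip s t : 1 <= s -> 1 <= t -> f i (x t i) - f i (x s i) <= S * `|t - s|.
  move=> s1 t1; apply: le_trans (grd _ _ (Xx t t1) (Xx s s1)) _.
  rewrite dotvE mulr_suml; apply: ler_sum => k _.
  rewrite (le_trans (ler_norm _))// normrM -mulrA ler_pM// ?(HG k).2// !mxE.
  exact: (HE k).2.
exists (`|f i (xs i)| + C + D + S); first by rewrite !addr_ge0.
move=> t t1; split.
  apply: (@le_trans _ _ (`|f i (xs i)| + C + D)); last by rewrite lerDl.
  apply: ler_norm_between => //.
    by rewrite (le_trans (grd _ _ (Xx t t1) Xs))// (le_trans (ler_norm _))// (HC t t1).1.
  rewrite (le_trans (grd _ _ Xs (Xx t t1)))// -(opprB (x t i)) dotvNr.
  by rewrite (le_trans (ler_norm _))// normrN (HD t t1).1.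
move=> s s1; apply: (@le_trans _ _ (S * `|t - s|)); last first.
  by rewrite ler_wpM2r// lerDr !addr_ge0.
rewrite ler_norml lerNl opprB lip//= andbT.
by rewrite distrC lip.
Qed.

Lemma diss_lip xs : attains xs -> boundedlip (diss xs).
Proof.
move=> hxs; have [lx lz ll lw] := state_lip hxs.
have d0 (s t : R) : 0 <= `|t - s| by [].
have lr i : boundedlipv (fun t => resid t i) := resid_incr d0 (lx i) (lz i).
have lq i : boundedlipv (fun t => dissent t i) := bincrv_blockmul d0 _ _ ll.
apply: bincrD.
  apply: (bincr_sum d0) => i.
  apply: bincrD; last exact: (bincrZ d0 _ (bincr_dotv d0 (lq i) (lq i))).
  apply: bincrD; last exact: (bincrZ d0 _ (bincr_dotv d0 (lr i) (lr i))).
  apply: (bincrZ d0); apply: (bincr_dotv d0); last exact: (bincrvB d0 (lw i) (lx i)).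
  exact: (bincrvB d0 (lx i) (bincrv_cst d0 _)).
apply: (bincrZ d0); apply: bincrD.
  apply: bincrD; last exact: bincr_cst.
  by apply: (bincr_sum d0) => i; exact: (f_lip i hxs).
apply: (bincr_dotv d0); first exact: bincrv_cst.
apply: (bincrvB d0); last exact: bincrv_cst.
move=> k; rewrite (_ : (fun t => _) = fun t => \sum_i (A i *m x t i) k 0).
  by apply: (bincr_sum d0) => i; exact: (bincrv_mulmx d0 _ (lx i)).
by apply/funext => t; rewrite summxE.
Qed.

(** * Vanishing dissipation, limit points and convergence *)

Lemma diss_cvg0 xs : attains xs -> diss xs t @[t --> +oo] --> (0 : R).
Proof.
move=> hxs; have [C C0 HC] := diss_lip hxs.
apply: (barbalat (@is_derive_lyap xs) (B := 0) (C := C)).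
- by move=> t t0; exact: dlyap_le.
- by move=> t t0; have [] := diss_ge hxs (ltW t0).
- by move=> t t1; apply: lyap_ge0 => //; rewrite (le_trans _ t1).
- by move=> s t s1 t1; exact: (HC t t1).2.
Qed.

Lemma lyap_cvg xs : attains xs -> exists v : R, lyap_t xs t @[t --> +oo] --> v.
Proof.
move=> hxs; apply: (@nonincreasing_cvg _ _ 0).
  by move=> s t s1 st; apply: lyap_nincr => //; rewrite (lt_le_trans _ s1).
by move=> t t1; apply: lyap_ge0 => //; rewrite (le_trans _ t1).
Qed.

(* The limit of the Lyapunov function along [x --> xs + v], up to a constant that
   does not depend on [xs]. *)
Definition quad (v : stk R d) :=
  \sum_i (2^-1 * dotv (v i) (v i) + (2 * alpha)^-1 * dotv (A i *m v i) (A i *m v i))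
  + (2 * beta)^-1 * \sum_i dotv (A i *m v i) (blockmul M (fun j => A j *m v j) i).

Lemma quad_diffv (y : stk R d) : quad (fun i => y i - y i) = 0.
Proof.
rewrite /quad !big1 ?mulr0 ?addr0// => i _; first by rewrite subrr mulmx0 dotv0l.
by rewrite subrr mulmx0 !dotv0l !mulr0 addr0.
Qed.

(** Both points satisfy the coupling constraint, so the vectors [A_i (xs_i - ys_i)] sum to 0, and on
    such families the [M] form is nonnegative. *)
Lemma quad_ge xs ys : attains xs -> attains ys ->
  2^-1 * \sum_i dotv (xs i - ys i) (xs i - ys i) <= quad (fun i => xs i - ys i).
Proof.
move=> [[Axs _] _] [[Ays _] _].
have S0 : \sum_i A i *m (xs i - ys i) = 0.
  under eq_bigr do rewrite mulmxBr.
  by rewrite sumrB -/(stk_mul A xs) -/(stk_mul A ys) Axs Ays subrr.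
rewrite /quad big_split/= -mulr_sumr -addrA lerDl addr_ge0//.
  by rewrite sumr_ge0// => i _; rewrite mulr_ge0 ?dotv_ge0// invr_ge0 mulr_ge0// ltW.
rewrite mulr_ge0 ?invr_ge0 ?mulr_ge0 ?(ltW beta_gt0)//.
rewrite -(pmulr_rge0 _ K_gt0); apply: le_trans (greenM S0).2.
by apply: sumr_ge0 => i _; exact: dotv_ge0.
Qed.

Lemma ultra_bounded1v {F : set_system R} {FU : UltraFilter F} m (u : R -> 'cV[R]_m) :
  pinfty_nbhs R `<=` F -> bounded1v u -> exists v : 'cV[R]_m, u t @[t --> F] --> v.
Proof.
move=> Foo bu.
have /choice[C HC] k : exists C, 0 <= C /\ forall t, 1 <= t -> `|u t k 0| <= C.
  by have [C C0 H] := bu k; exists C; split => // t /H[].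
apply: (ultra_bounded_cvg_col (C := \sum_k C k)); apply: Foo.
near=> t => k; have t1 : 1 <= t by near: t; apply: nbhs_pinfty_ge; exact: num_real.
rewrite (le_trans ((HC k).2 t t1))// (bigD1 k)//= lerDl sumr_ge0// => j _.
exact: (HC j).1.
Unshelve. all: by end_near. Qed.

(* Limit points of the trajectory along ultrafilters: their existence needs only
   boundedness, and all the components converge simultaneously. *)
Lemma limit_state {F : set_system R} {FU : UltraFilter F} xs0 :
  pinfty_nbhs R `<=` F -> attains xs0 ->
  exists (xF : stk R d) (c : R), [/\ forall i, x t i @[t --> F] --> xF i, attains xF &
    forall xs, attains xs -> lyap_t xs t @[t --> F] --> quad (fun i => xF i - xs i) + c].
Proof.
move=> Foo hxs0; have [bx bz bl] := state_bounded hxs0.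
have bw i := w_bounded (bx i) (bz i) (bl i).
have ex_x i := cid (ultra_bounded1v (FU := FU) Foo (bx i)).
have ex_w i := cid (ultra_bounded1v (FU := FU) Foo (bw i)).
have ex_l i := cid (ultra_bounded1v (FU := FU) Foo (bl i)).
have ex_z i := cid (ultra_bounded1v (FU := FU) Foo (bz i)).
pose xF : stk R d := fun i => projT1 (ex_x i).
pose wF : stk R d := fun i => projT1 (ex_w i).
pose lF i := projT1 (ex_l i); pose zF i := projT1 (ex_z i).
have cx i : x t i @[t --> F] --> xF i := projT2 (ex_x i).
have cw i : w t i @[t --> F] --> wF i := projT2 (ex_w i).
have cl i : lam t i @[t --> F] --> lF i := projT2 (ex_l i).
have cz i : z t i @[t --> F] --> zF i := projT2 (ex_z i).
have F0 : F [set t | 0 <= t] by apply: Foo; apply: nbhs_pinfty_ge; exact: num_real.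
have dF xs : attains xs -> diss xs t @[t --> F] --> (0 : R).
  by move=> hxs U /(diss_cvg0 hxs); exact: Foo.
(* A quantity dominated by [diss] has a limit at most 0; applied to nonnegative terms of [diss],
   this forces the limit 0. *)
have le0 xs (c : R) (g : R -> R) (v : R) : attains xs -> 0 < c -> g t @[t --> F] --> v ->
    (forall t, 0 <= t -> c * g t <= diss xs t) -> v <= 0.
  move=> hxs c0 gv gd; rewrite -(pmulr_rle0 _ c0).
  have cg : c * g t @[t --> F] --> c * v by exact: cvgMl_tmp.
  by apply: ler_cvg_to cg (dF _ hxs) _; apply: filterS F0 => t; exact: gd.
have cr i : resid t i @[t --> F] --> A i *m xF i - bs i - zF i.
  by apply: cvgB => //; apply: cvgB; [exact: cvg_mulmx|exact: cvg_cst].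
have rF i : A i *m xF i - bs i - zF i = 0.
  apply: dotv_eq0; apply/eqP; rewrite eq_le dotv_ge0 andbT.
  apply: (le0 _ 2^-1 _ _ hxs0 _ (cvg_dotv (cr i) (cr i))) => // t t0.
  by have [_ + _ _ _] := diss_ge hxs0 t0; exact.
have cbm (B : 'M[R]_n) (u : R -> 'I_n -> 'cV[R]_p) (v : 'I_n -> 'cV[R]_p) i :
    (forall j, u t j @[t --> F] --> v j) -> blockmul B (u t) i @[t --> F] --> blockmul B v i.
  by move=> uv; apply: cvg_sum_fin => j; apply: cvgZl_tmp; exact: uv.
have cq i : dissent t i @[t --> F] --> blockmul L lF i by exact: cbm.
have qF i : blockmul L lF i = 0.
  apply: dotv_eq0; apply/eqP; rewrite eq_le dotv_ge0 andbT.
  apply: (le0 _ (beta ^+ 2 / 2) _ _ hxs0 _ (cvg_dotv (cq i) (cq i))) => [|t t0].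
    by rewrite divr_gt0// exprn_gt0.
  by have [_ _ + _ _] := diss_ge hxs0 t0; exact.
have szF : \sum_i zF i = 0.
  have c1 : \sum_i z t i @[t --> F] --> \sum_i zF i by exact: cvg_sum_fin.
  have c2 : \sum_i z t i @[t --> F] --> (0 : 'cV[R]_p).
    by apply: cvg_near_cst; apply: filterS F0 => t; exact: sum_z.
  exact: (cvg_unique _ c1 c2).
have AxF : stk_mul A xF = b.
  have : \sum_i (A i *m xF i - bs i - zF i) = 0 by apply: big1 => i _; exact: rF.
  by rewrite !sumrB szF subr0 sum_bs => /eqP; rewrite subr_eq0 => /eqP.
have XxF : prodset X xF.
  move=> i; have [clX _] := freg i.
  apply: (closed_cvg (X i) clX _ _ (cx i)); apply: filterS F0 => t t0.
  by have [] := traj_proj i t0.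
have cgap : gap (x t) @[t --> F] --> (0 : R).
  apply/cvgrPdist_lt => e e0.
  have H : F [set t | diss xs0 t < alpha * e] := cvgr_lt _ (dF _ hxs0) _ (mulr_gt0 alpha_gt0 e0).
  near=> t; have t0 : 0 <= t by near: t; exact: F0.
  have de : diss xs0 t < alpha * e by near: t; exact: H.
  rewrite sub0r normrN ger0_norm ?gap_x_ge0// -(ltr_pM2l alpha_gt0).
  by apply: le_lt_trans de; have [_ _ _ +] := diss_ge hxs0 t0.
have fxF : \sum_i f i (xF i) = fopt.
  apply/eqP; rewrite eq_le; apply/andP; split; last first.
    by have := saddle XxF; rewrite AxF subrr dotv0r addr0.
  (* [h t] is [f (x t)] plus the linear correction at [xF], so the gradient inequality at [xF] puts
     [f xF] below it; since the gap vanishes and [xF] is feasible, its limit is [fopt]. *)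
  pose h t := fopt + gap (x t) - dotv l (stk_mul A (x t) - b)
     + \sum_i dotv (grad (f i) (xF i)) (xF i - x t i).
  have ch : h t @[t --> F] --> fopt + 0 - dotv l (stk_mul A xF - b)
     + \sum_i dotv (grad (f i) (xF i)) (xF i - xF i).
    apply: cvgD; last first.
      apply: cvg_sum_fin => i; apply: cvg_dotv; first exact: cvg_cst.
      exact: (cvgB (cvg_cst _) (cx i)).
    apply: cvgB; first by apply: cvgD => //; exact: cvg_cst.
    apply: cvg_dotv; first exact: cvg_cst.
    apply: cvgB; last exact: cvg_cst.
    by apply: cvg_sum_fin => i; exact: cvg_mulmx.
  move: ch; rewrite AxF subrr dotv0r subr0 addr0 [X in _ + X]big1 ?addr0 => [ch|i _]; last first.
    by rewrite subrr dotv0r.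
  apply: (cvgr_to_ge ch); apply: filterS F0 => t t0; rewrite /h /gap.
  rewrite addrA addrK addrCA subrr addr0 -big_split/=.
  apply: ler_sum => i _; rewrite -(opprB (x t i)) dotvNr lerBrDr.
  have [_ [_ [cf [U [_ [XU [dU _]]]]]]] := freg i.
  have Xx : X i (x t i) by have [] := traj_proj i t0.
  exact: convex_grad_le cf (XxF i) Xx (dU _ (XU _ (XxF i))).
have hF : attains xF by [].
exists xF, (alpha / 2 * \sum_i dotv (lF i - l) (lF i - l)); split => // xs hxs.
have czt i : zerr xs (z t) i @[t --> F] --> zerr xs zF i
  by exact: (cvgB (cz i) (cvg_cst _)).
have cxs i : x t i - xs i @[t --> F] --> xF i - xs i
  by exact: (cvgB (cx i) (cvg_cst _)).
have cws i : w t i - xs i @[t --> F] --> wF i - xs i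
  by exact: (cvgB (cw i) (cvg_cst _)).
have cwx i : w t i - x t i @[t --> F] --> wF i - xF i
  by exact: (cvgB (cw i) (cx i)).
have cls i : lam t i - l @[t --> F] --> lF i - l
  by exact: (cvgB (cl i) (cvg_cst _)).
have -> : quad (fun i => xF i - xs i) + alpha / 2 * \sum_i dotv (lF i - l) (lF i - l) =
    lyap xs wF xF lF zF.
  have zE i : zerr xs zF i = A i *m (xF i - xs i).
    have e : zF i = A i *m xF i - bs i by apply/esym/eqP; rewrite -subr_eq0 rF.
    by rewrite /zerr /zstar e mulmxBr opprB addrA subrK.
  (* The limit of [w] disappears from the limit value through this orthogonality. *)
  have pF i : dotv (xF i - xs i) (wF i - xF i) = 0.
    have c1 : dotv (x t i - xs i) (w t i - x t i) @[t --> F] --> dotv (xF i - xs i) (wF i - xF i).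
      exact: (cvg_dotv (cxs i) (cwx i)).
    apply/eqP; rewrite eq_le; apply/andP; split.
      apply: (le0 _ alpha _ _ hxs alpha_gt0 c1) => t t0.
      by have [+ _ _ _ _] := diss_ge hxs t0; exact.
    by apply: (cvgr_to_ge c1); apply: filterS F0 => t; exact: proj_gap_ge0.
  have zt : \sum_i zerr xs zF i = 0 by rewrite sumrB szF sum_zstar// subrr.
  have [LMz _] := greenM zt.
  (* The cross term that could tie the constant to [xs]: [zerr] is in the range of [L] and has zero
     sum, while [lF] is in the kernel of [L] and [l] is the same for all agents. *)
  have zl : \sum_i dotv (zerr xs zF i) (lF i - l) = 0.
    under eq_bigr do rewrite dotvDr; rewrite big_split/= -dotv_suml zt dotv0l addr0.
    under eq_bigr do rewrite -LMz.
    by rewrite -dotv_blockmul ?tr_laplacian// big1// => i _; rewrite qF dotv0r.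
  rewrite /lyap [\sum_i dotv (lF i) _]big1 ?mulr0 ?addr0 => [|i _]; last by rewrite qF dotv0r.
  rewrite /quad addrAC; congr (_ + _ * _); last first.
    apply: eq_bigr => i _; rewrite zE; congr dotv.
    by apply: eq_blockmul => j; rewrite zE.
  rewrite -[LHS]addr0 -[X in _ + X = _]zl mulr_sumr -!big_split/=; apply: eq_bigr => i _.
  rewrite -zE.
  have -> : dotv (wF i - xs i) (wF i - xs i) - dotv (wF i - xF i) (wF i - xF i) =
      dotv (xF i - xs i) (xF i - xs i) + 2 * dotv (xF i - xs i) (wF i - xF i).
    have -> : wF i - xs i = (wF i - xF i) + (xF i - xs i) by rewrite addrA subrK.
    rewrite [LHS](congr1 (fun r => r - _) (dotvDl _ _ _)) !(dotvDr _ (wF i - xF i) (xF i - xs i)).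
    by rewrite (dotvC (wF i - xF i) (xF i - xs i)); ring.
  rewrite pF mulr0 addr0.
  move: (zerr xs zF i) (lF i - l) => u v.
  rewrite !dotvDl !dotvDr !dotvZl !dotvZr (dotvC v u).
  by field; rewrite gt_eqF.
rewrite /lyap_t /lyap; apply: cvgD; last first.
  apply: cvgMl_tmp; apply: cvg_sum_fin => i; apply: cvg_dotv => //.
  exact: cbm.
apply: cvgD; last first.
  apply: cvgMl_tmp; apply: cvg_sum_fin => i; apply: cvg_dotv => //.
  exact: (cbm M (fun t => zerr xs (z t))).
apply: cvg_sum_fin => i; apply: cvgD; apply: cvgMl_tmp.
  exact: (cvgB (cvg_dotv (cws i) (cws i)) (cvg_dotv (cwx i) (cwx i))).
have cm : zerr xs (z t) i + alpha *: (lam t i - l) @[t --> F] -->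
    zerr xs zF i + alpha *: (lF i - l) 
  by apply: cvgD; [exact: czt|apply: cvgZl_tmp; exact: cls].
exact: (cvg_dotv cm cm).
Unshelve. all: by end_near. Qed.

Lemma trajectory_cvg xs0 : attains xs0 ->
  exists x1, attains x1 /\ forall i, x t i @[t --> +oo] --> x1 i.
Proof.
move=> hxs0.
have [F1 [FU1 F1oo]] := ultraFilterLemma (@proper_pinfty_nbhs R).
have [x1 [c1 [cx1 h1 cV1]]] := limit_state F1oo hxs0.
exists x1; split=> //.
pose T t := \sum_i dotv (x t i - x1 i) (x t i - x1 i).
suff T0 e : 0 < e -> \forall t \near +oo, T t < e.
  move=> i; apply: cvg_colP => k; apply/cvgrPdist_lt => e e0.
  have := T0 (e ^+ 2) (exprn_gt0 2 e0); apply: filterS => t Te.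
  rewrite distrC -(ltr_pXn2r (ltn0Sn 1)) ?nnegrE ?(ltW e0)//.
  rewrite real_normK ?num_real//; apply: le_lt_trans Te.
  have -> : x t i k 0 - x1 i k 0 = (x t i - x1 i) k 0 by rewrite !mxE.
  rewrite (le_trans (sqr_coord_le_dotv _ _))// /T (bigD1 i)//= lerDl.
  by rewrite sumr_ge0// => j _; exact: dotv_ge0.
move=> e0; apply: contrapT => nT.
have [F2 [FU2 F2oo F2T]] := ultra_not_near nT.
have [x2 [c2 [cx2 h2 cV2]]] := limit_state F2oo hxs0.
have T2 : e <= \sum_i dotv (x2 i - x1 i) (x2 i - x1 i).
  have cT : T t @[t --> F2] --> \sum_i dotv (x2 i - x1 i) (x2 i - x1 i).
    by apply: cvg_sum_fin => i; apply: cvg_dotv; exact: (cvgB (cx2 i) (cvg_cst _)).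
  by apply: (cvgr_to_ge cT); apply: filterS F2T => t /negP; rewrite -leNgt.
have [v1 cv1] := lyap_cvg h1; have [v2 cv2] := lyap_cvg h2.
have up (F : set_system R) : ProperFilter F -> pinfty_nbhs R `<=` F ->
    forall (g : R -> R) (v v' : R), g t @[t --> +oo] --> v -> g t @[t --> F] --> v' -> v' = v.
  move=> FF Foo g v v' gv gv'.
  have gvF : g t @[t --> F] --> v by move=> U Uv; apply: Foo; exact: (gv U Uv).
  exact: (cvg_unique _ gv' gvF).
(* Each Lyapunov function has the same limit along both ultrafilters. Since [quad] vanishes at 0,
   this reads [v1 = c1], [v2 = c2], and the two mixed values of [quad] are [v2 - v1] and
   [v1 - v2]. *)
have e11 := up F1 _ F1oo _ _ _ cv1 (cV1 _ h1).
have e12 := up F1 _ F1oo _ _ _ cv2 (cV1 _ h2).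
have e21 := up F2 _ F2oo _ _ _ cv1 (cV2 _ h1).
have e22 := up F2 _ F2oo _ _ _ cv2 (cV2 _ h2).
rewrite quad_diffv add0r in e11; rewrite quad_diffv add0r in e22.
have S0 : quad (fun i => x1 i - x2 i) + quad (fun i => x2 i - x1 i) = 0.
  move: e12 e21; rewrite e11 e22 => e12 e21.
  by rewrite -(addrK v1 (quad (fun i => x1 i - x2 i))) e12 -[X in _ + X](addrK v2) e21; ring.
have q1 := quad_ge h1 h2; have q2 := quad_ge h2 h1.
have q0 : 0 <= quad (fun i => x1 i - x2 i).
  by apply: le_trans q1; rewrite mulr_ge0// sumr_ge0// => i _; exact: dotv_ge0.
have : 2^-1 * e <= 0.
  rewrite -S0; apply: le_trans (_ : quad (fun i => x2 i - x1 i) <= _); last by rewrite lerDr.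
  by apply: le_trans q2; rewrite ler_pM2l.
by rewrite leNgt mulr_gt0.
Qed.

End Trajectory.

Theorem theorem5 (R : realType) (n p : nat) (d : 'I_n -> nat)
  (f : forall i : 'I_n, 'cV[R]_(d i) -> R)
  (X : forall i : 'I_n, set 'cV[R]_(d i))
  (A : forall i : 'I_n, 'M[R]_(p, d i)) (b : 'cV[R]_p)
  (* problem (P) has at least one optimal solution *)
  (Hopt : exists xo : stk R d, optimal f X A b xo)
  (* Assumption 1 *)
  (Hreg : forall i : 'I_n, agent_regular (X i) (f i))
  (Hslater : exists xs : stk R d,
      rel_interior (prodset X) xs /\ stk_mul A xs = b)
  (* undirected connected weighted graph *)
  (a : 'M[R]_n) (Ha_nonneg : nonneg_adj a) (Ha_undir : undirected a)
  (Ha_conn : connected_graph a)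
  (* Proj-IDEA parameters and data split *)
  (alpha beta : R) (Halpha : 0 < alpha) (Hbeta : 0 < beta)
  (bs : 'I_n -> 'cV[R]_p) (Hbs : \sum_(i < n) bs i = b)
  (* a trajectory of Proj-IDEA with sum_i z_i(0) = 0 *)
  (w : R -> stk R d) (lam z : R -> 'I_n -> 'cV[R]_p) (x : R -> stk R d)
  (Htraj : proj_idea_traj f X A bs a alpha beta w lam z x)
  (Hz0 : \sum_(i < n) z 0 i = 0) :
  exists xstar : stk R d, optimal f X A b xstar /\
    forall i : 'I_n, x t i @[t --> +oo] --> xstar i.
Proof.
have [xo hxo] := Hopt.
have cvx i : convex_setv (X i) /\ convex_on (X i) (f i).
  by have [_ [cX [cf _]]] := Hreg i.
have [l hl] := strong_duality hxo cvx Hslater.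
have [M [K [trM K0 green]]] := laplacian_green (p := p) Ha_nonneg Ha_undir Ha_conn.
have [|x1 [[fx1 vx1] cx]] := trajectory_cvg Hreg Ha_nonneg Ha_undir Halpha Hbeta Hbs
    Htraj Hz0 trM K0 green hl (xs0 := xo).
  by split => //; exact: hxo.1.
by exists x1; split => //; split => // y hy; rewrite vx1; exact: hxo.2.
Qed.
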